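(* Let $k\in\mathbb{N}$, $k\ge1$, and suppose $N=3k(k+1)+1$. Then the ground state with $N$ atoms is, up to rigid motions, uniquely given by $$\mathcal{S}_N=\mathcal{L}\cap\operatorname{conv}\bigl(B_1^{(k)},\dots,B_6^{(k)}\bigr),$$ i.e. this set is a ground state with $N$ atoms, and every ground state with $N$ atoms is the image of this set under a rigid motion of $\mathbb{R}^2$.
   Context: The energy of $N$ particles at positions $x_1,\dots,x_N\in\mathbb{R}^2$ is $E(x_1,\dots,x_N)=\sum_{i\ne j}V_{\rm HR}(|x_i-x_j|)$, where $V_{\rm HR}(r)=+\infty$ for $0\le r<1$, $V_{\rm HR}(1)=-1$, and $V_{\rm HR}(r)=0$ for $r>1$. A ground state with $N$ atoms is a set $\{x_1,\dots,x_N\}\subset\mathbb{R}^2$ of $N$ points minimizing $E$ among all $N$-particle configurations. The triangular lattice is $\mathcal{L}=\{me_1+ne_2: m,n\in\mathbb{Z}\}$ with $e_1=(1,0)$, $e_2=\frac12(1,\sqrt3)$. The points $B_i^{(k)}$ are $B_1^{(k)}=k(e_1-e_2)$, $B_2^{(k)}=ke_1$, $B_3^{(k)}=ke_2$, $B_4^{(k)}=-B_1^{(k)}$, $B_5^{(k)}=-B_2^{(k)}$, $B_6^{(k)}=-B_3^{(k)}$, and $\operatorname{conv}$ denotes the convex hull. *)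

(* Defs.v *)
From HB Require Import structures.
From mathcomp Require Import all_boot all_order all_algebra.
From mathcomp Require Import all_classical all_reals all_analysis.

Set Implicit Arguments.
Unset Strict Implicit.
Unset Printing Implicit Defensive.

Import Order.TTheory GRing.Theory Num.Theory.

Local Open Scope classical_set_scope.
Local Open Scope ring_scope.

(* Points of the plane are row vectors.  The library norm on 'rV[R]_2 is the
   sup norm, so the Euclidean norm is defined here. *)
Definition enorm {R : realType} (x : 'rV[R]_2) : R :=
  Num.sqrt (\sum_(j < 2) x ord0 j ^+ 2).

Definition V_HR {R : realType} (r : R) : \bar R :=
  if r < 1 then +oo%E else if r == 1 then (-1)%:E else 0%E.

(* The sum runs over ordered pairs, so every bond is counted twice.  No term is
   -oo, hence the sum in \bar R involves no indeterminate form. *)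
Definition energy {R : realType} (N : nat) (x : 'I_N -> 'rV[R]_2) : \bar R :=
  (\sum_(i < N) \sum_(j < N | i != j) V_HR (enorm (x i - x j)))%E.

Definition ground_state {R : realType} (N : nat) (S : set 'rV[R]_2) : Prop :=
  exists x : 'I_N -> 'rV[R]_2,
    [/\ S = range x, injective x
      & forall y : 'I_N -> 'rV[R]_2, (energy x <= energy y)%E].

Definition point {R : realType} (a b : R) : 'rV[R]_2 :=
  \row_(j < 2) (if j == ord0 then a else b).

Definition e1 {R : realType} : 'rV[R]_2 := point 1 0.
Definition e2 {R : realType} : 'rV[R]_2 := 2^-1 *: point 1 (Num.sqrt 3).

Definition triangular_lattice {R : realType} : set 'rV[R]_2 :=
  [set x | exists m n : int, x = m%:~R *: e1 + n%:~R *: e2].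

Definition convex_hull {R : realType} (A : set 'rV[R]_2) : set 'rV[R]_2 :=
  smallest (@convex_set R 'rV[R]_2) A.

Definition B1 {R : realType} (k : nat) : 'rV[R]_2 := k%:R *: (e1 - e2).
Definition B2 {R : realType} (k : nat) : 'rV[R]_2 := k%:R *: e1.
Definition B3 {R : realType} (k : nat) : 'rV[R]_2 := k%:R *: e2.
Definition B4 {R : realType} (k : nat) : 'rV[R]_2 := - B1 k.
Definition B5 {R : realType} (k : nat) : 'rV[R]_2 := - B2 k.
Definition B6 {R : realType} (k : nat) : 'rV[R]_2 := - B3 k.

Definition hexagon {R : realType} (k : nat) : set 'rV[R]_2 :=
  triangular_lattice `&`
  convex_hull [set` [:: B1 k; B2 k; B3 k; B4 k; B5 k; B6 k]].

(* Orientation-preserving: a rotation followed by a translation.  The hexagon is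
   mirror symmetric, so allowing reflections would change nothing.  Row vectors
   are acted on from the right. *)
Definition rigid_motion {R : realType} (f : 'rV[R]_2 -> 'rV[R]_2) : Prop :=
  exists (Q : 'M[R]_2) (t : 'rV[R]_2),
    [/\ Q *m Q^T = 1%:M, \det Q = 1 & forall x, f x = x *m Q + t].

(* Main.v *)
Require Import Defs.
From mathcomp Require Import all_classical all_reals all_analysis.
From mathcomp Require Import all_boot all_order all_algebra.
From mathcomp Require Import trigo ring lra zify.

(* Harborth's count of unit distances, with the planarity of the bond graph
   replaced by angle sums.  A closed unit polygon whose vertices are 1-separated
   has total turn 2 pi or -2 pi: the direction of x_j - x_i turns by 0 around
   each cell (i, j), because the four differences lie in a common half-plane.
   If the bond graph is biconnected, walk from an extreme point, always taking
   the rightmost bond.  When the walk first meets itself, it has closed a cycle;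
   a bond on the right of this cycle would extend to an ear, and the total turns
   of the three cycles of the theta graph are incompatible with the ear coming
   back on the left.  Hence the cycle carries all bonds on its left, and its
   interior angles, each at least (deg - 1) pi / 3, sum to (b - 2) pi.  So the
   degrees of its b vertices sum to at most 4 b - 6, and removing them gives
   (6 n - E)^2 >= 48 n - 12 by induction, where E counts ordered bonds (a cut
   vertex only makes this strict).
   For n = 3 k (k + 1) + 1, equality forces the remaining points to be optimal
   for k - 1 and to have six neighbours each, so by induction they are a hexagon
   whose lattice neighbours are all occupied; counting finishes the proof. *)

Set Implicit Arguments.
Unset Strict Implicit.
Unset Printing Implicit Defensive.

Import Order.TTheory GRing.Theory Num.Theory.

(** * Oriented angles *)

Section Angles.
Local Open Scope ring_scope.
Variable R : realType.
Implicit Types (u v w m : R * R) (a b r : R).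

Definition dot u v : R := u.1 * v.1 + u.2 * v.2.
Definition crs u v : R := u.1 * v.2 - u.2 * v.1.

(** The signed angle from [u] to [v], in ]-pi, pi]. The cut is at opposite vectors, where the value
    is pi. *)
Definition turn u v : R :=
  let c := acos (dot u v / Num.sqrt (dot u u * dot v v)) in
  if 0 <= crs u v then c else - c.

(** The angle from [u] counterclockwise to [v], in [0, 2 pi[. Measuring from [- v] moves the cut to
    equal directions, where the value is 0. *)
Definition ccw u v : R := pi - turn (- v) u.

Lemma dotC u v : dot u v = dot v u.
Proof. by rewrite /dot; ring. Qed.
Lemma crsC u v : crs u v = - crs v u.
Proof. by rewrite /crs; ring. Qed.
Lemma dotNl u v : dot (- u) v = - dot u v.
Proof. by rewrite /dot /=; ring. Qed.
Lemma dotNr u v : dot u (- v) = - dot u v.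
Proof. by rewrite /dot /=; ring. Qed.
Lemma crsNl u v : crs (- u) v = - crs u v.
Proof. by rewrite /crs /=; ring. Qed.
Lemma crsNr u v : crs u (- v) = - crs u v.
Proof. by rewrite /crs /=; ring. Qed.
Lemma lagrange u v : dot u u * dot v v = dot u v ^+ 2 + crs u v ^+ 2.
Proof. by rewrite /dot /crs /=; ring. Qed.
(** In complex terms, conj(conj(m) u) (conj(m) v) = |m|^2 conj(u) v. Its real part here and its
    imaginary part in the next lemma reduce the angle between [u] and [v] to their angles against
    [m]. *)
Lemma dot_dot m u v : dot m m * dot u v = dot m u * dot m v + crs m u * crs m v.
Proof. by rewrite /dot /crs /=; ring. Qed.
Lemma dot_crs m u v : dot m m * crs u v = dot m u * crs m v - crs m u * dot m v.
Proof. by rewrite /dot /crs /=; ring. Qed.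
Lemma dot_ge0 u : 0 <= dot u u.
Proof. by rewrite /dot; nra. Qed.
Lemma dot_gt0_arg m u : 0 < dot m u -> 0 < dot m m /\ 0 < dot u u.
Proof.
move=> h; rewrite !lt0r !dot_ge0 !andbT; split; apply/eqP => h0.
  have [m1 m2] : m.1 = 0 /\ m.2 = 0 by move: h0; rewrite /dot; split; nra.
  by move: h; rewrite /dot m1 m2; lra.
have [m1 m2] : u.1 = 0 /\ u.2 = 0 by move: h0; rewrite /dot; split; nra.
by move: h; rewrite /dot m1 m2; lra.
Qed.

Lemma abs_pi_sin_gt0 a : 0 < a -> a < pi -> 0 < sin a :> R.
Proof. by move=> a0 api; apply: sin_gt0_pi; rewrite a0. Qed.

(** By this uniqueness of the polar form, identities between turns follow from the addition formulas
    for cos and sin. *)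
Lemma turn_uniq u v r a : 0 < r -> dot u v = r * cos a -> crs u v = r * sin a ->
  - pi < a -> a <= pi -> turn u v = a.
Proof.
move=> r0 hd hc h1 h2.
have hr : Num.sqrt (dot u u * dot v v) = r.
  rewrite lagrange hd hc !exprMn -mulrDr cos2Dsin2 mulr1 sqrtr_sqr ger0_norm//.
  exact: ltW.
rewrite /turn hr hd mulrAC divff ?gt_eqF// mul1r hc pmulr_rge0//.
case: ifPn => [|/negbTE] hs.
  rewrite cosK// in_itv/= h2 andbT leNgt; apply/negP => a0.
  have := @abs_pi_sin_gt0 (- a); rewrite sinN; lra.
rewrite cosKN ?opprK// (ltW h1) /= leNgt; apply/negP => a0.
by rewrite sin_ge0_pi ?(ltW a0) ?h2 in hs.
Qed.

Lemma turn_spec u v : 0 < dot u u -> 0 < dot v v ->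
  let r := Num.sqrt (dot u u * dot v v) in
  [/\ 0 < r, dot u v = r * cos (turn u v), crs u v = r * sin (turn u v),
      - pi < turn u v & turn u v <= pi].
Proof.
move=> hu hv r.
have r0 : 0 < r by rewrite sqrtr_gt0 mulr_gt0.
have rr : r ^+ 2 = dot u v ^+ 2 + crs u v ^+ 2.
  by rewrite sqr_sqrtr ?lagrange// addr_ge0// sqr_ge0.
set c := dot u v / r.
have hc : dot u v = r * c by rewrite /c mulrCA divff ?mulr1// gt_eqF.
have c1 : c ^+ 2 <= 1.
  rewrite -(ler_pM2l (exprn_gt0 2 r0)) -exprMn -hc mulr1 rr lerDl sqr_ge0//.
have cI : -1 <= c <= 1 by apply/andP; split; nra.
have sa : `|crs u v| = r * sin (acos c).
  rewrite sin_acos// -[in LHS]sqrtr_sqr -[r in RHS]gtr0_norm// -[`|r|]sqrtr_sqr.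
  rewrite -sqrtrM ?sqr_ge0//; congr Num.sqrt; rewrite mulrBr -exprMn -hc rr; ring.
have ca : cos (acos c) = c by rewrite acosK// in_itv.
have p0 := pi_gt0 R.
have := acos_ge0 cI; have := acos_lepi cI => a1 a0.
rewrite /turn -/r -/c; case: ifPn => hs.
  by split => //; [rewrite ca|rewrite -sa ger0_norm|lra].
split => //; first by rewrite cosN ca.
- by rewrite sinN mulrN -sa ltr0_norm ?opprK// ltNge.
- rewrite ltrN2 lt_neqAle a1 andbT; apply/eqP => e.
  by move: sa; rewrite e sinpi mulr0 => /normr0_eq0 z; rewrite z lexx in hs.
- lra.
Qed.

Lemma turn_half m u : 0 < dot m u -> - (pi / 2) < turn m u < pi / 2.
Proof.
move=> h; have [hm hu] := dot_gt0_arg h.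
have [r0 hd _ t1 t2] := turn_spec hm hu.
rewrite hd pmulr_rgt0// in h.
have p0 := pi_gt0 R.
rewrite -ltr_norml -ltr_cos ?in_itv/=; first by rewrite cos_pihalf cos_norm.
  by rewrite normr_ge0 ler_norml t2 andbT ltW.
by apply/andP; split; lra.
Qed.

(** In the open half-plane around [m], angles against [m] stay in ]-pi/2, pi/2[. Their differences
    never reach the cut, so no multiple of 2 pi has to be added. *)
Lemma turn_half_sub m u v : 0 < dot m u -> 0 < dot m v ->
  turn u v = turn m v - turn m u.
Proof.
move=> hu hv; have [hm hu0] := dot_gt0_arg hu; have [_ hv0] := dot_gt0_arg hv.
have [ru du cu _ _] := turn_spec hm hu0; have [rv dv cv _ _] := turn_spec hm hv0.
have /andP[a1 a2] := turn_half hu; have /andP[b1 b2] := turn_half hv.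
set s := Num.sqrt _ in ru du cu; set t := Num.sqrt _ in rv dv cv.
apply: (@turn_uniq _ _ (s * t / dot m m)) => //.
- by rewrite divr_gt0// mulr_gt0.
- apply: (mulfI (lt0r_neq0 hm)); rewrite dot_dot du dv cu cv cosB; field.
  exact: lt0r_neq0.
- apply: (mulfI (lt0r_neq0 hm)); rewrite dot_crs du dv cu cv sinB; field.
  exact: lt0r_neq0.
- lra.
- lra.
Qed.

Lemma turn_add m u v w : 0 < dot m u -> 0 < dot m v -> 0 < dot m w ->
  turn u v + turn v w = turn u w.
Proof.
move=> hu hv hw; rewrite (turn_half_sub hu hv) (turn_half_sub hv hw).
by rewrite (turn_half_sub hu hw); ring.
Qed.

Lemma turnNN u v : turn (- u) (- v) = turn u v.
Proof. by rewrite /turn !dotNl !dotNr !opprK crsNl crsNr opprK. Qed.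

Lemma turnC m u v : 0 < dot m u -> 0 < dot m v -> turn v u = - turn u v.
Proof.
by move=> hu hv; rewrite (turn_half_sub hu hv) (turn_half_sub hv hu) opprB.
Qed.

(** Passing from [u] through [v] to [- u] is a half turn, whose sense is the sign of the cross
    product. *)
Lemma turn_compl u v : 0 < dot u u -> 0 < dot v v -> crs u v != 0 ->
  turn v (- u) = (if 0 < crs u v then pi else - pi) - turn u v.
Proof.
move=> hu hv c0; have [r0 hd hc t1 t2] := turn_spec hu hv.
have p0 := pi_gt0 R.
have tpi : turn u v != pi by apply: contraNneq c0 => h; rewrite hc h sinpi mulr0.
have {}t2 : turn u v < pi by rewrite lt_neqAle tpi.
apply: (turn_uniq r0).
- rewrite dotNr dotC hd; case: ifP => _; rewrite ?cosB ?cosN ?sinN cospi sinpi; ring.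
- rewrite crsNr crsC opprK hc; case: ifP => _; rewrite sinB ?cosN ?sinN cospi sinpi; ring.
- case: ifPn => h; first by lra.
  have : crs u v < 0 by rewrite lt_neqAle c0 leNgt.
  rewrite hc pmulr_rlt0// => h1; rewrite ltNge; apply/negP => h2.
  have : 0 <= turn u v by lra.
  by move=> h3; move: h1; rewrite ltNge sin_ge0_pi// h3 ltW.
- case: ifPn => h; last by lra.
  move: h; rewrite hc pmulr_rgt0// => h1; rewrite leNgt; apply/negP => h2.
  have := @abs_pi_sin_gt0 (- turn u v); rewrite sinN; lra.
Qed.

Lemma turn_ge0 u v : 0 < dot u u -> 0 < dot v v -> (0 <= turn u v) = (0 <= crs u v).
Proof.
move=> hu hv; have [r0 hd hc t1 t2] := turn_spec hu hv.
rewrite hc pmulr_rge0//; apply/idP/idP => h; first by rewrite sin_ge0_pi// h t2.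
rewrite leNgt; apply/negP => h2.
have := @abs_pi_sin_gt0 (- turn u v); rewrite sinN; lra.
Qed.

Lemma ccw_spec u v : 0 < dot u u -> 0 < dot v v ->
  exists r, [/\ 0 < r, r ^+ 2 = dot u u * dot v v, dot u v = r * cos (ccw u v),
    crs u v = r * sin (ccw u v) & 0 <= ccw u v < 2 * pi].
Proof.
move=> hu hv; have hv' : 0 < dot (- v) (- v) by rewrite dotNl dotNr opprK.
have [r0 hd hc t1 t2] := turn_spec hv' hu.
exists (Num.sqrt (dot (- v) (- v) * dot u u)); split => //.
- by rewrite sqr_sqrtr ?dotNl ?dotNr ?opprK ?mulr_ge0 ?dot_ge0// mulrC.
- rewrite /ccw cosB cospi sinpi mulrDr mulrCA -hd dotNl dotC; ring.
- rewrite /ccw sinB cospi sinpi; move: hc; rewrite crsNl crsC opprK => ->; ring.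
- by rewrite /ccw; apply/andP; split; lra.
Qed.

Lemma ccw_uniq u v r a : 0 < r -> dot u v = r * cos a -> crs u v = r * sin a ->
  0 <= a -> a < 2 * pi -> ccw u v = a.
Proof.
move=> r0 hd hc a0 a2; rewrite /ccw (@turn_uniq _ _ r (pi - a))//.
- by rewrite opprB addrC subrK.
- rewrite dotNl dotC hd cosB cospi sinpi; ring.
- rewrite crsNl crsC opprK hc sinB cospi sinpi; ring.
- lra.
- lra.
Qed.

(** Both angles are measured from [f]; the summand 2 pi appears when the sweep from [u] to [v]
    passes [f]. *)
Lemma ccw_rebase f u v : 0 < dot f f -> 0 < dot u u -> 0 < dot v v ->
  ccw u v = ccw f v - ccw f u + (if ccw f u <= ccw f v then 0 else 2 * pi).
Proof.
move=> hf hu hv; have [s [s0 _ sd sc /andP[s1 s2]]] := ccw_spec hf hu.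
have [t [t0 _ td tc /andP[t1 t2]]] := ccw_spec hf hv.
apply: (@ccw_uniq _ _ (s * t / dot f f)) => //.
- by rewrite divr_gt0// mulr_gt0.
- apply: (mulfI (lt0r_neq0 hf)); rewrite dot_dot sd td sc tc.
  case: ifP => _; first by rewrite addr0 cosB; field; exact: lt0r_neq0.
  by rewrite (mulr_natl pi) cosD2pi cosB; field; exact: lt0r_neq0.
- apply: (mulfI (lt0r_neq0 hf)); rewrite dot_crs sd td sc tc.
  case: ifP => _; first by rewrite addr0 sinB; field; exact: lt0r_neq0.
  by rewrite (mulr_natl pi) sinD2pi sinB; field; exact: lt0r_neq0.
- by case: (leP (ccw f u)) => ?; lra.
- by case: (leP (ccw f u)) => ?; lra.
Qed.

(** The triple-angle formula turns cos pi = -1 into (c + 1) (2 c - 1)^2 = 0, whose only positive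
    root is 1/2. *)
Lemma cos_pi3 : cos (pi / 3) = 2^-1 :> R.
Proof.
have p0 := pi_gt0 R.
have c0 : 0 < cos (pi / 3) :> R by apply: cos_gt0_pihalf; apply/andP; split; lra.
have : cos pi = 4 * cos (pi / 3) ^+ 3 - 3 * cos (pi / 3) :> R.
  have {1}-> : pi = pi / 3 + (pi / 3) *+ 2 :> R by rewrite mulr2n; lra.
  rewrite cosD cos_mulr2n sin_mulr2n !mulr2n.
  have := sin2cos2 (pi / 3 : R); set c := cos _; set s := sin _ => e.
  transitivity (c * (2 * c ^+ 2 - 1) - 2 * c * s ^+ 2); first by ring.
  rewrite e; ring.
rewrite cospi; move: c0; set c := cos _ => c0 e.
have : (c + 1) * (2 * c - 1) ^+ 2 = 0.
  transitivity (4 * c ^+ 3 - 3 * c + 1); first by ring.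
  by rewrite -e; ring.
move/eqP; rewrite mulf_eq0 expf_eq0 /= => /orP[] /eqP; lra.
Qed.

Lemma sin_pi3 : sin (pi / 3) = Num.sqrt 3 / 2 :> R.
Proof.
have p0 := pi_gt0 R.
have s0 : 0 < sin (pi / 3) :> R by apply: abs_pi_sin_gt0; lra.
have s3 : 0 <= Num.sqrt 3 / 2 :> R by rewrite divr_ge0// sqrtr_ge0.
have h : sin (pi / 3) ^+ 2 = (Num.sqrt 3 / 2) ^+ 2 :> R.
  by rewrite sin2cos2 cos_pi3 exprMn sqr_sqrtr// exprVn; field.
have /eqP : (sin (pi / 3) - Num.sqrt 3 / 2) * (sin (pi / 3) + Num.sqrt 3 / 2) = 0 :> R.
  by rewrite -subr_sqr h subrr.
by rewrite mulf_eq0 => /orP[] /eqP; lra.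
Qed.

Lemma cos_gt_half a : `|a| < pi / 3 -> 2^-1 < cos a :> R.
Proof.
move=> h; have p0 := pi_gt0 R.
rewrite -cos_pi3 -(cos_norm a) ltr_cos// in_itv/=; last by lra.
by rewrite normr_ge0; lra.
Qed.

Lemma ccw_unit u v : dot u u = 1 -> dot v v = 1 ->
  dot u v = cos (ccw u v) /\ crs u v = sin (ccw u v).
Proof.
move=> hu hv; have [||r [r0 r2 -> -> _]] := @ccw_spec u v; rewrite ?hu ?hv ?ltr01//.
suff -> : r = 1 by rewrite !mul1r.
move: r2; rewrite hu hv mulr1 => /eqP; rewrite -subr_eq0 subr_sqr_1 mulf_eq0.
by move=> /orP[] /eqP; lra.
Qed.

Lemma ccw_bounds u v : 0 < dot u u -> 0 < dot v v -> 0 <= ccw u v < 2 * pi.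
Proof. by move=> hu hv; have [r []] := ccw_spec hu hv. Qed.

(** [dot u v] is the cosine of the difference of the two angles; a difference below pi/3 would make
    it exceed 1/2. *)
Lemma ccw_sep f u v : dot f f = 1 -> dot u u = 1 -> dot v v = 1 ->
  dot u v <= 2^-1 -> pi / 3 <= `|ccw f u - ccw f v|.
Proof.
move=> hf hu hv huv; rewrite leNgt; apply/negP => /cos_gt_half.
have [du su] := ccw_unit hf hu; have [dv sv] := ccw_unit hf hv.
by rewrite cosB -du -su -dv -sv -dot_dot hf mul1r ltNge huv.
Qed.

Lemma ccw_self u : 0 < dot u u -> ccw u u = 0.
Proof.
move=> hu; apply: (@ccw_uniq _ _ (dot u u)) => //.
- by rewrite cos0 mulr1.
- by rewrite sin0 mulr0 /crs; ring.
- by rewrite mulr_gt0// pi_gt0.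
Qed.

Lemma turn_ccw u v : turn u v = pi - ccw v (- u).
Proof. by rewrite /ccw !opprK opprB addrC subrK. Qed.

End Angles.

(** * The turning number of a closed unit polygon *)

Section Hopf.
Local Open Scope ring_scope.
Variable R : realType.
Implicit Types (a b c d : R * R).

Definition sqd a b : R := dot (b - a) (b - a).

Lemma sqdC a b : sqd a b = sqd b a.
Proof. by rewrite /sqd /dot /=; ring. Qed.

(* The midpoint difference separates two disjoint unit segments. *)
Lemma segments_half a b c d : sqd a b = 1 -> sqd c d = 1 -> 1 <= sqd a c ->
  1 <= sqd a d -> 1 <= sqd b c -> 1 <= sqd b d ->
  0 < dot ((c - a) + (d - b)) (c - a).
Proof.
have := dot_ge0 ((c - d) - (b - a)).
by rewrite /sqd /dot /=; lra.
Qed.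

(** All four differences lie in the half-plane of [m], where turns add, so both sides equal
    [turn (c - a) (d - b)]. *)
Lemma turn_cell a b c d : sqd a b = 1 -> sqd c d = 1 -> 1 <= sqd a c ->
  1 <= sqd a d -> 1 <= sqd b c -> 1 <= sqd b d ->
  turn (c - a) (d - a) + turn (d - a) (d - b) =
  turn (c - a) (c - b) + turn (c - b) (d - b).
Proof.
move=> ab cd ac ad bc bd; pose m := (c - a) + (d - b).
have h1 : 0 < dot m (c - a) by apply: segments_half.
have h2 : 0 < dot m (d - a).
  have -> : m = (d - a) + (c - b) by rewrite /m; ring.
  by apply: segments_half => //; rewrite sqdC.
have h3 : 0 < dot m (c - b).
  have -> : m = (c - b) + (d - a) by rewrite /m; ring.
  by apply: segments_half => //; rewrite sqdC.
have h4 : 0 < dot m (d - b).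
  have -> : m = (d - b) + (c - a) by rewrite /m; ring.
  by apply: segments_half => //; rewrite sqdC.
by rewrite (turn_add h1 h2 h4) (turn_add h1 h3 h4).
Qed.

(** The separation of [a] and [c] bounds the product of the two unit edges below by -1/2, so both
    edges lie in the half-plane of [c - a]. *)
Lemma turn_corner a b c : sqd a b = 1 -> sqd b c = 1 -> 1 <= sqd a c ->
  turn (b - a) (c - b) = turn (b - a) (c - a) + turn (c - a) (c - b).
Proof.
move=> ab bc ac; rewrite (@turn_add _ (c - a))//; move: ab bc ac;
  by rewrite /sqd /dot /=; lra.
Qed.

Lemma turn_corner_lt a b c : sqd a b = 1 -> sqd b c = 1 -> 1 <= sqd a c ->
  turn (c - b) (b - a) = - turn (b - a) (c - b).
Proof.
move=> ab bc ac; rewrite (@turnC _ (c - a))//; move: ab bc ac;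
  by rewrite /sqd /dot /=; lra.
Qed.

(** Parallel unit vectors are equal or opposite. The first is excluded by the product, the second by
    the common half-plane. *)
Lemma crs_neq0_half (m e f : R * R) : dot e e = 1 -> dot f f = 1 ->
  dot e f <= 2^-1 -> 0 < dot m e -> 0 < dot m f -> crs e f != 0.
Proof.
move=> ee ff ef he hf; apply/eqP => c0; have := lagrange e f.
rewrite c0 ee ff mulr1 expr0n /= addr0 => /esym/eqP; rewrite sqrf_eq1.
move=> /orP[]/eqP d1; first by move: ef; rewrite d1; lra.
have := dot_dot e m f; rewrite ee mul1r c0 mulr0 addr0 d1 (dotC e m).
by move: he hf; lra.
Qed.

Variables (x : nat -> R * R) (n k : nat) (m : R * R).
Hypothesis nE : n = k.+3.
Hypothesis xn : x n = x 0%N.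
Hypothesis xn1 : x n.+1 = x 1%N.
Hypothesis unit_edge : forall i, (i < n)%N -> sqd (x i) (x i.+1) = 1.
Hypothesis sep : forall i j, (i < j < n)%N -> 1 <= sqd (x i) (x j).
Hypothesis half : forall j, (0 < j < n)%N -> 0 < dot m (x j - x 0%N).

(** The directions [x j - x i] are indexed by the triangle i < j. [H] and [V] are the turns when j,
    respectively i, advances by one; [tau] is the step along the diagonal of edges. *)
Let H i j := turn (x j - x i) (x j.+1 - x i).
Let V i j := turn (x j - x i) (x j - x i.+1).
Let tau i := turn (x i.+1 - x i) (x i.+2 - x i.+1).

(** Only the pair (0, n) is excluded, where the two points coincide. *)
Let sep' i j : (i < j <= n)%N -> (0 < i)%N || (j < n)%N -> 1 <= sqd (x i) (x j).
Proof.
move=> /andP[ij]; rewrite leq_eqVlt => /orP[/eqP jn|jn].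
  by move: ij; rewrite jn ltnn orbF xn sqdC => ij i0; apply: sep; lia.
by move=> _; apply: sep; lia.
Qed.

Let cell i j : (i.+1 < j < n)%N -> (0 < i)%N || (j.+1 < n)%N ->
  H i j + V i j.+1 = V i j + H i.+1 j.
Proof.
move=> ij i0; apply: turn_cell.
- by apply: unit_edge; lia.
- by apply: unit_edge; lia.
- by apply: sep'; lia.
- by apply: sep'; lia.
- by apply: sep'; lia.
- by apply: sep'; lia.
Qed.

Let corner i : (i.+1 < n)%N -> tau i = H i i.+1 + V i i.+2.
Proof.
move=> ii; apply: turn_corner.
- by apply: unit_edge; lia.
- by apply: unit_edge; lia.
- by apply: sep'; lia.
Qed.

(** Adds up the cells of column j between rows s and t. *)
Let slide (s t j : nat) : (s <= t)%N -> (t < j < n)%N -> (0 < s)%N || (j.+1 < n)%N ->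
  \sum_(s <= i < t) V i j + H t j = H s j + \sum_(s <= i < t) V i j.+1.
Proof.
move=> st tj s0; rewrite -(subnKC st).
have : (s + (t - s) <= t)%N by lia.
elim: (t - s)%N => [|l IH] h; first by rewrite addn0 !big_geq// add0r addr0.
rewrite addnS !big_nat_recr ?leq_addr//= -addrA -cell; try lia.
by rewrite addrA IH; [rewrite addrA|lia].
Qed.

(** The diagonal path from (0, 1) to (j, j + 1) is deformed into row 0 followed by column j + 1. *)
Let fan j : (j.+1 < n)%N ->
  \sum_(0 <= i < j) tau i = \sum_(1 <= l < j.+1) H 0 l + \sum_(0 <= i < j) V i j.+1.
Proof.
elim: j => [|j IH] h; first by rewrite !big_geq// addr0.
rewrite [LHS]big_nat_recr//= IH; last lia.
rewrite (big_nat_recr j.+1 1)//= (big_nat_recr j 0%N)//= corner; last lia.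
have := @slide 0 j j.+1 (leq0n j); rewrite ltnSn h (ltnW h) => /(_ isT isT) s.
by lra.
Qed.

(** The diagonal is deformed into row 0 and column n, avoiding the degenerate pair (0, n) by way of
    (1, n - 1). Row and column each contribute [turn e f]; the detour and the last corner each
    contribute [turn f (- e)]. The two angles are complementary, which gives twice pi or twice
    -pi. *)
Lemma hopf_halfplane :
  let e := x 1%N - x 0%N in let f := x n.-1 - x 0%N in
  \sum_(0 <= i < n) turn (x i.+1 - x i) (x i.+2 - x i.+1) =
  if 0 < crs e f then 2 * pi else - (2 * pi).
Proof.
move=> e f.
have n1 : n.-1.+1 = n by rewrite nE.
have ee : dot e e = 1 by apply: unit_edge; lia.
have ff : dot f f = 1.
  have : sqd (x n.-1) (x n.-1.+1) = 1 by apply: unit_edge; lia.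
  by rewrite n1 xn sqdC.
have ef : dot e f <= 2^-1.
  have : 1 <= sqd (x 1%N) (x n.-1) by apply: sep; lia.
  by move: ee ff; rewrite /e /f /sqd /dot /=; lra.
have he : 0 < dot m e by apply: half; lia.
have hf : 0 < dot m f by apply: half; lia.
have c0 : crs e f != 0 by apply: crs_neq0_half he hf.
have fE : f = x k.+2 - x 0%N by rewrite /f nE.
have telH : \sum_(1 <= l < k.+2) H 0 l = turn e f.
  rewrite (turn_half_sub he hf) fE -[RHS](telescope_sumr (fun l => turn m (x l - x 0%N)))//.
  by apply: eq_big_nat => i hi; apply: turn_half_sub; apply: half; lia.
(* Since [x n = x 0], the directions in column n are the negatives of those in row 0. *)
have telV : \sum_(1 <= i < k.+2) V i n = turn e f.
  rewrite (turn_half_sub he hf) fE -[RHS](telescope_sumr (fun l => turn m (x l - x 0%N)))//.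
  apply: eq_big_nat => i hi; rewrite /V xn -(opprB (x i)) -(opprB (x i.+1)) turnNN.
  by apply: turn_half_sub; apply: half; lia.
have mid : V 0 k.+2 + H 1 k.+2 = turn f (- e).
  rewrite /V /H -nE xn opprB -fE; apply: (@turn_add _ (x k.+2 - x 1%N)).
  - by move: ee ff ef; rewrite fE /e /dot /=; lra.
  - by move: ee ff ef; rewrite fE /e /dot /=; lra.
  - by move: ee ff ef; rewrite fE /e /dot /=; lra.
rewrite nE big_nat_recr//= -nE xn xn1 -/e -(opprB (x k.+2)) -fE.
rewrite -[e in turn (- f) e]opprK turnNN.
rewrite -[\sum_(0 <= i < k.+2) _]/(\sum_(0 <= i < k.+2) tau i) big_nat_recr//= fan; last lia.
rewrite telH corner; last lia.
rewrite [\sum_(0 <= i < _) _]big_ltn//.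
have := @slide 1 k.+1 k.+2 isT; rewrite nE !ltnSn /= => /(_ isT isT) s.
rewrite nE in telV.
transitivity (turn e f + (V 0 k.+2 + (\sum_(1 <= i < k.+1) V i k.+2 + H k.+1 k.+2))
  + V k.+1 k.+3 + turn f (- e)); first by ring.
rewrite s; transitivity (turn e f + (V 0 k.+2 + H 1 k.+2) +
  (\sum_(1 <= i < k.+1) V i k.+3 + V k.+1 k.+3) + turn f (- e)); first by ring.
rewrite -big_nat_recr//= telV mid turn_compl ?ee ?ff ?ltr01//.
by case: ifP => _; ring.
Qed.

End Hopf.

(** * Sums over consecutive triples of a sequence *)

Section TripleSum.
Local Open Scope ring_scope.
Variables (R : realType) (T : eqType).
Implicit Types (g : T -> T -> T -> R) (P Q : T -> T -> T -> Prop) (s l : seq T).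

Fixpoint triple_sum g s : R :=
  if s is a :: s' then (if s' is b :: c :: _ then g a b c else 0) + triple_sum g s' else 0.

Fixpoint triple_all P s : Prop :=
  if s is a :: s' then (if s' is b :: c :: _ then P a b c else True) /\ triple_all P s'
  else True.

(** Repeating the first two entries makes every corner of the cyclic sequence a consecutive
    triple. *)
Definition close_up s := s ++ take 2 s.

Lemma triple_sum_nth v g s : triple_sum g s =
  \sum_(0 <= i < (size s).-2) g (nth v s i) (nth v s i.+1) (nth v s i.+2).
Proof.
elim: s => [|a [|b [|c s]] IH]; first by rewrite big_geq.
- by rewrite big_geq//= addr0.
- by rewrite big_geq//= !addr0.
by rewrite big_nat_recl//=; congr (_ + _); move: IH => /= ->.
Qed.

Lemma triple_sum_cat2 g l a b s :
  triple_sum g (l ++ a :: b :: s) = triple_sum g (l ++ [:: a; b]) + triple_sum g (a :: b :: s).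
Proof.
elim: l => [|x [|y [|z l]] IH]; first by rewrite /=; ring.
- by rewrite /=; ring.
- by move: IH; rewrite /= => ->; ring.
- by move: IH; rewrite /= => ->; ring.
Qed.

Lemma triple_sum_join g a l w b s : triple_sum g (a :: l ++ w :: b :: s) =
  triple_sum g (a :: l ++ [:: w]) + g (last a l) w b + triple_sum g (w :: b :: s).
Proof.
elim: l a => [|c [|d l] IH] a; first by rewrite /=; ring.
- by move: (IH c); rewrite /= => ->; ring.
- by move: (IH c); rewrite /= => ->; ring.
Qed.

Lemma triple_sum_rev g s : triple_sum g (rev s) = triple_sum (fun a b c => g c b a) s.
Proof.
elim: s => [//|a [//|b [|c s]] IH]; first by rewrite /rev /= !addr0.
have -> : rev (a :: b :: c :: s) = rev s ++ c :: b :: [:: a].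
  by rewrite !rev_cons -!cats1 -!catA.
rewrite triple_sum_cat2 /= !addr0 addrC; congr (_ + _).
by move: IH; rewrite !rev_cons -!cats1 -!catA /= => ->.
Qed.

Lemma triple_sum_rot n g s : (1 < size s)%N ->
  triple_sum g (close_up (rot n s)) = triple_sum g (close_up s).
Proof.
move=> s1; case: (ltnP n (size s)) => [|/rot_oversize->//].
elim: n => [|n IH] ns; first by rewrite rot0.
rewrite (rotS (ltnW ns)) -IH ?(ltnW ns)//.
have : (1 < size (rot n s))%N by rewrite size_rot.
case: (rot n s) => [//|a [//|b l]] _.
rewrite rot1_cons.
have -> : close_up (rcons (b :: l) a) = (b :: l) ++ a :: b :: [:: head a l].
  by rewrite /close_up -cats1 -catA; case: l => [|c l] /=; rewrite ?take0.
rewrite triple_sum_cat2 /close_up /= take0.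
by case: l => [|c l] /=; ring.
Qed.

(** Only the corners at [v] and [w] involve both arcs, so exchanging an arc for an ear changes just
    that arc and these two terms. *)
Lemma triple_sum_close_up2 g v s1 w s2 : triple_sum g (close_up (v :: s1 ++ w :: s2)) =
  triple_sum g (v :: s1 ++ [:: w]) + triple_sum g (w :: s2 ++ [:: v]) +
  (g (last v s1) w (head v s2) + g (last w s2) v (head w s1)).
Proof.
have -> : close_up (v :: s1 ++ w :: s2) = v :: s1 ++ w :: (s2 ++ [:: v; head w s1]).
  by rewrite /close_up /= -catA; case: s1 => [|a s1] /=; rewrite ?take0.
have -> : s2 ++ [:: v; head w s1] =
    head v s2 :: behead (s2 ++ [:: v; head w s1]) by case: s2.
rewrite triple_sum_join.
have <- : s2 ++ [:: v; head w s1] =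
    head v s2 :: behead (s2 ++ [:: v; head w s1]) by case: s2.
by rewrite triple_sum_join /= !addr0; ring.
Qed.

Lemma triple_sum_le g g' s :
  triple_all (fun a b c => g a b c <= g' a b c) s -> triple_sum g s <= triple_sum g' s.
Proof.
elim: s => [//|a s IH] [h /IH hs] /=; apply: lerD hs.
by case: s h {IH} => [|b [|c s]].
Qed.

Lemma triple_sum_eq g g' s :
  triple_all (fun a b c => g a b c = g' a b c) s -> triple_sum g s = triple_sum g' s.
Proof.
elim: s => [//|a s IH] [h /IH hs] /=; congr (_ + _) => //.
by case: s h {IH hs} => [|b [|c s]].
Qed.

Lemma triple_all_imp P Q s : (forall a b c, P a b c -> Q a b c) -> triple_all P s -> triple_all Q s.
Proof.
move=> PQ; elim: s => [//|a s IH] [h /IH hs]; split=> // {IH hs}.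
by case: s h => [|b [|c s]] //; apply: PQ.
Qed.

Lemma triple_all_cat P l a b s : triple_all P (l ++ [:: a; b]) -> triple_all P (a :: b :: s) ->
  triple_all P (l ++ a :: b :: s).
Proof.
move=> + h; elim: l => [|x [|y [|z l]] IH] //= [h1 h2]; split => //; exact: IH.
Qed.

Lemma triple_all_catr P l s : triple_all P (l ++ s) -> triple_all P s.
Proof. by elim: l => [//|x l IH] /= [_ /IH]. Qed.

Lemma triple_all_mid P l a b c s : triple_all P (l ++ a :: b :: c :: s) -> P a b c.
Proof. by move/triple_all_catr => /= []. Qed.

Lemma triple_sum_mid (f : T -> R) a l b :
  triple_sum (fun _ b _ => f b) (a :: l ++ [:: b]) = \sum_(i <- l) f i.
Proof.
elim: l a => [|c l IH] a; first by rewrite /= !addr0 big_nil.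
by rewrite big_cons -(IH c); case: l {IH}.
Qed.

Lemma triple_sum_close_up_mid (f : T -> R) s : (1 < size s)%N ->
  triple_sum (fun _ b _ => f b) (close_up s) = \sum_(a <- s) f a.
Proof.
case: s => [//|a [//|b s]] _.
transitivity (triple_sum (fun _ b _ => f b) (a :: (b :: s ++ [:: a]) ++ [:: b])).
  by congr triple_sum; rewrite /close_up /= take0 -catA.
by rewrite triple_sum_mid cats1 -rcons_cons; apply: perm_big; rewrite perm_rcons.
Qed.

End TripleSum.

(** * Cycles and ears in the bond graph *)

Section PermEar.
Variables (T : eqType) (v w : T) (s1 s2 r : seq T).
Let s := v :: s1 ++ w :: s2 ++ r.

(** The ear itself and, below, the two cycles that it forms with the arcs are completed to the
    vertex list of the theta graph; this transfers [uniq] to them. *)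
Lemma perm_ear1 : perm_eq ((v :: r ++ [:: w]) ++ s1 ++ s2) s.
Proof.
apply/permP => a; rewrite /= !count_cat /= !count_cat.
by move: (nat_of_bool _) (nat_of_bool _) => x y; lia.
Qed.

Lemma perm_ear2 : perm_eq ((v :: r ++ w :: s2) ++ s1) s.
Proof.
apply/permP => a; rewrite /= !count_cat /= !count_cat.
by move: (nat_of_bool _) (nat_of_bool _) => x y; lia.
Qed.

Lemma perm_ear3 : perm_eq ((v :: s1 ++ w :: rev r) ++ s2) s.
Proof.
apply/permP => a; rewrite /= !count_cat /= !count_cat count_rev.
by move: (nat_of_bool _) (nat_of_bool _) => x y; lia.
Qed.
End PermEar.

Section Cycles.
Local Open Scope ring_scope.
Variables (R : realType) (T : finType) (p : T -> R * R).
Hypothesis psep : forall i j, i != j -> 1 <= sqd (p i) (p j).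

Definition adj : rel T := fun i j => sqd (p i) (p j) == 1.
Definition tau a b c : R := turn (p b - p a) (p c - p b).
(** The interior angle at [b] on the left of the walk [a], [b], [c]; [tau] is the corresponding
    exterior angle. *)
Definition ang b c a : R := ccw (p c - p b) (p a - p b).

Lemma adj_sym : symmetric adj.
Proof. by move=> i j; rewrite /adj sqdC. Qed.

Lemma adj_neq i j : adj i j -> i != j.
Proof.
apply: contraTneq => ->; rewrite /adj /sqd /dot subrr /= mulr0 addr0.
by rewrite eq_sym oner_eq0.
Qed.

Lemma adj_gt0 i j : adj i j -> 0 < dot (p j - p i) (p j - p i).
Proof. by move/eqP; rewrite /sqd => ->. Qed.

(** An isosceles triangle with unit legs and base at least 1 has apex angle at least pi/3. *)
Lemma adj_dot b a c : adj b a -> adj b c -> a != c ->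
  dot (p a - p b) (p c - p b) <= 2^-1.
Proof.
move=> /eqP ba /eqP bc /psep; move: ba bc; rewrite /sqd /dot /=; lra.
Qed.

Lemma tau_rev a b c : adj a b -> adj b c -> a != c -> tau c b a = - tau a b c.
Proof.
move=> /eqP ab /eqP bc /psep ac; rewrite /tau.
rewrite -(opprB (p c) (p b)) -(opprB (p b) (p a)) turnNN.
exact: turn_corner_lt.
Qed.

Lemma tau_ang a b c : tau a b c = pi - ang b c a.
Proof. by rewrite /tau turn_ccw (opprB (p b) (p a)). Qed.

Lemma ang_sep b c a a' : adj b c -> adj b a -> adj b a' -> a != a' ->
  pi / 3 <= `|ang b c a - ang b c a'|.
Proof.
move=> bc ba ba' aa'; apply: ccw_sep; rewrite -/(sqd _ _);
  by [apply/eqP|apply: adj_dot].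
Qed.

Lemma ang_bounds b c a : adj b c -> adj b a -> 0 <= ang b c a < 2 * pi.
Proof. by move=> bc ba; apply: ccw_bounds; apply: adj_gt0. Qed.

Lemma ang_self b c : adj b c -> ang b c c = 0.
Proof. by move=> bc; apply: ccw_self; apply: adj_gt0. Qed.

Lemma ang_neq b c a a' : adj b c -> adj b a -> adj b a' -> a != a' ->
  ang b c a != ang b c a'.
Proof.
move=> bc ba ba' /(ang_sep bc ba ba'); apply: contraTneq => ->.
by rewrite subrr normr0 -ltNge divr_gt0 ?pi_gt0.
Qed.

(* An extra edge x-y at the corner a-x-b lies on its left or on its right. *)
Lemma tau_split a x y b : adj x a -> adj x y -> adj x b ->
  tau a x y + tau y x b - tau a x b = if ang x b y <= ang x b a then pi else - pi.
Proof.
move=> xa xy xb; rewrite !tau_ang.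
rewrite /ang (@ccw_rebase _ (p b - p x) (p y - p x)) ?adj_gt0//.
by case: ifP => _; ring.
Qed.

Lemma hopf_cycle v s m : uniq (v :: s) -> cycle adj (v :: s) -> (1 < size s)%N ->
  (forall y, y \in s -> 0 < dot m (p y - p v)) ->
  triple_sum tau (close_up (v :: s)) =
  if 0 < crs (p (head v s) - p v) (p (last v s) - p v) then 2 * pi else - (2 * pi).
Proof.
move=> us cs s2 hm; pose n := (size s).+1.
pose x i := p (nth v (close_up (v :: s)) i).
have clE : close_up (v :: s) = rcons (v :: s) v ++ [:: head v s].
  by rewrite /close_up -cats1 -catA; case: (s) s2 => [//|a l] _ /=; rewrite take0.
(* At i = n the right-hand side falls back on the default [v], which is the closing vertex. *)
have nthE i : (i <= n)%N -> nth v (close_up (v :: s)) i = nth v (v :: s) i.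
  by move=> ii; rewrite clE nth_cat size_rcons ltnS ii nth_rcons_default.
have x_lt i : (i <= n)%N -> x i = p (nth v (v :: s) i) by move=> ii; rewrite /x nthE.
have szE : size (close_up (v :: s)) = n.+2 by rewrite clE size_cat size_rcons addn1.
have xn : x n = x 0 by rewrite x_lt// nth_default// /x.
have xn1 : x n.+1 = x 1.
  rewrite [RHS]x_lt// /x clE nth_cat size_rcons ltnn subnn /=.
  by case: (s).
rewrite (triple_sum_nth v) szE /=.
have := @hopf_halfplane _ x n (size s).-2 m _ xn xn1.
have -> : n = (size s).-2.+3 by rewrite /n; lia.
move=> /(_ erefl); rewrite -[(size s).-2.+3]/((size s).-2.+2.+1).
have -> : (size s).-2.+2 = size s by lia.
rewrite -/n => /(_ _ _ _) H; rewrite H /=.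
- by rewrite (x_lt 1)// (x_lt 0)// (x_lt (size s)) ?leqnSn// -last_nth /= nth0.
- move=> i ii; rewrite !x_lt//; last exact: ltnW.
  apply/eqP; move: cs; rewrite /cycle => /(pathP v) /(_ i).
  by rewrite size_rcons -rcons_cons !nth_rcons_default => /(_ ii).
- move=> i j /andP[ij jn]; rewrite !x_lt ?(ltnW jn)// ?(ltnW (ltn_trans ij jn))//.
  apply: psep; rewrite nth_uniq ?(ltn_trans ij jn)//; lia.
- move=> j /andP[j0 jn]; rewrite !x_lt ?(ltnW jn)//=.
  by apply: hm; case: j j0 jn => //= j _ jn; rewrite mem_nth.
Qed.

(** A vertex [v] farthest from the origin sees all other vertices in the open half-plane of [- p v],
    so the cycle is rotated to start there. *)
Lemma cycle_turn s : uniq s -> cycle adj s -> (2 < size s)%N ->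
  triple_sum tau (close_up s) = 2 * pi \/ triple_sum tau (close_up s) = - (2 * pi).
Proof.
case: s => [//|i0 s0] us cs s2; set s := i0 :: s0 in us cs s2 *.
have i0s : i0 \in s by rewrite mem_head.
case: (@Order.TotalTheory.arg_maxP _ _ T i0 (mem s) (fun y => dot (p y) (p y)) i0s).
move=> v vs vmax; case: (rot_to vs) => i s' rs.
rewrite -(@triple_sum_rot _ _ i) ?(ltnW s2)// rs.
rewrite (@hopf_cycle v s' (- p v)).
- by case: ifP => _; [left|right].
- by rewrite -rs rot_uniq.
- by rewrite -rs rot_cycle.
- by rewrite -ltnS -[(size s').+1]/(size (v :: s')) -rs size_rot.
move=> y ys'; have yv : y != v.
  by apply: contraTneq ys' => ->; have := rot_uniq i s; rewrite rs us => /andP[].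
have ys : y \in s by rewrite -(mem_rot i) rs inE ys' orbT.
have := vmax y ys; have := psep yv; rewrite /sqd /dot /=; lra.
Qed.

Lemma tau_path_rev v s : path adj v s -> uniq (v :: s) ->
  triple_sum tau (rev (v :: s)) = - triple_sum tau (v :: s).
Proof.
move=> ps us; rewrite triple_sum_rev.
have -> : - triple_sum tau (v :: s) = triple_sum (fun a b c => - tau a b c) (v :: s).
  elim: (v :: s) => [|a l /= <-]; first by rewrite /= oppr0.
  by rewrite opprD; case: l => [|b [|c l]]; rewrite ?oppr0.
apply: triple_sum_eq; elim: s v ps us => [|a [|b s] IH] v //= /and3P[va ab ps] us.
split; last by apply: IH; [rewrite /= ab|case/andP: us].
by apply: tau_rev => //; move: us; rewrite !inE !negb_or => /andP[/and3P[]].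
Qed.

(* The two cycles cut out by an ear v - r - w have turns +-2pi, and these add up
   to the turn of the whole cycle plus the contributions of the two ends; by
   parity, the ear leaves and re-enters the cycle on the same side. *)
Lemma ear_side v s1 w s2 r :
  let s := v :: s1 ++ w :: s2 in
  uniq (s ++ r) -> cycle adj s -> path adj v (rcons r w) ->
  (0 < size r + size s1)%N -> (0 < size r + size s2)%N ->
  (0 < size s1 + size s2)%N ->
  (ang v (head w s1) (head w r) <= ang v (head w s1) (last w s2)) =
  (ang w (head v s2) (last v r) <= ang w (head v s2) (last v s1)).
Proof.
move=> s us cs pr z1 z2 z3.
have p0 := pi_gt0 R.
have us' : uniq (v :: s1 ++ w :: s2 ++ r) by move: us; rewrite /s /= -catA.
have C1 : path adj v (rcons s1 w) /\ path adj w (rcons s2 v).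
  move: cs; rewrite /s /= rcons_cat /= cat_path /= => /and3P[h1 h2 h3].
  by rewrite rcons_path h1 h2.
case: C1 => ps1 ps2.
have prr : path adj w (rcons (rev r) v).
  move: pr; rewrite -(rev_path _ _ (rcons r w)) last_rcons belast_rcons rev_cons.
  by rewrite (@eq_path _ _ adj)// => a b; rewrite adj_sym.
have up : uniq (v :: r ++ [:: w]).
  suff : uniq ((v :: r ++ [:: w]) ++ s1 ++ s2) by rewrite cat_uniq => /andP[].
  by rewrite (perm_uniq (perm_ear1 v w s1 s2 r)).
have u' : uniq (v :: r ++ w :: s2).
  suff : uniq ((v :: r ++ w :: s2) ++ s1) by rewrite cat_uniq => /andP[].
  by rewrite (perm_uniq (perm_ear2 v w s1 s2 r)).
have u'' : uniq (v :: s1 ++ w :: rev r).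
  suff : uniq ((v :: s1 ++ w :: rev r) ++ s2) by rewrite cat_uniq => /andP[].
  by rewrite (perm_uniq (perm_ear3 v w s1 s2 r)).
have u0 : uniq s by move: us; rewrite cat_uniq => /andP[].
have cyc t1 t2 : path adj v (rcons t1 w) -> path adj w (rcons t2 v) ->
    cycle adj (v :: t1 ++ w :: t2).
  by rewrite /= rcons_cat cat_path /= rcons_path => /andP[-> ->].
have c' := cyc _ _ pr ps2; have c'' := cyc _ _ ps1 prr.
have n0 : (2 < size s)%N by rewrite /= size_cat /= addnS !ltnS.
have n' : (2 < size (v :: r ++ w :: s2))%N by rewrite /= size_cat /= addnS !ltnS.
have n'' : (2 < size (v :: s1 ++ w :: rev r))%N.
  by rewrite /= size_cat /= size_rev addnS !ltnS addnC.
have := cycle_turn u0 cs n0; have := cycle_turn u' c' n'.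
have := cycle_turn u'' c'' n''; rewrite !triple_sum_close_up2.
have -> : head v (rev r) = last v r.
  by case/lastP: (r) => [//|l a]; rewrite rev_rcons last_rcons.
have -> : last w (rev r) = head w r by case: (r) => [//|a l]; rewrite rev_cons last_rcons.
have -> : triple_sum tau (w :: rev r ++ [:: v]) = - triple_sum tau (v :: r ++ [:: w]).
  rewrite -tau_path_rev ?cats1//; last by rewrite -cats1.
  by rewrite rev_cons rev_rcons.
have vfP : adj v (head w r) by case: (r) pr => [|a l] /= /andP[].
have vfA : adj v (head w s1) by case: (s1) ps1 => [|a l] /= /andP[].
have wfB : adj w (head v s2) by case: (s2) ps2 => [|a l] /= /andP[].
have wlA : adj w (last v s1) by move: ps1; rewrite rcons_path adj_sym => /andP[].
have wlP : adj w (last v r) by move: pr; rewrite rcons_path adj_sym => /andP[].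
have vlB : adj v (last w s2) by move: ps2; rewrite rcons_path adj_sym => /andP[].
have := tau_split vlB vfP vfA; have := tau_split wlA wlP wfB.
set bv := (ang v _ _ <= _); set bw := (ang w _ _ <= _).
move=> ew ev h1 h2 h3.
(* If the sides differed, the end terms pi and -pi would cancel, and two summands from {2 pi, -2 pi}
   would add up to 2 pi or -2 pi. *)
move: ew ev; case: bv; case: bw => //= ew ev; exfalso;
  by case: h1; case: h2; case: h3; move: ew ev; lra.
Qed.

End Cycles.

(** * The boundary cycle *)

(** Induction on the set: the element of least value is removed, and all others lie at least [s]
    above it. *)
Lemma separated_card (R : realType) (T : finType) (phi : T -> R) (s : R) (n : nat)
    (B : {set T}) (lo hi : R) : #|B| = n.+1 ->
  {in B &, forall x y, x != y -> s <= `|phi x - phi y|}%R ->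
  {in B, forall x, lo <= phi x <= hi}%R -> (n%:R * s <= hi - lo)%R.
Proof.
elim: n B lo => [|n IH] B lo hB hs hb.
  have /card_gt0P[x xB] : (0 < #|B|)%N by rewrite hB.
  by have := hb x xB; lra.
have /card_gt0P[x0 x0B] : (0 < #|B|)%N by rewrite hB.
case: (@Order.TotalTheory.arg_minP _ _ T x0 (mem B) phi x0B) => x xB0 xmin.
have xB : x \in B by [].
have hB' : #|B :\ x| = n.+1 by move: hB; rewrite (cardsD1 x) xB => -[].
have := hb x xB; have H := IH _ (phi x + s)%R hB'; rewrite -natr1.
suff : (n%:R * s <= hi - (phi x + s))%R by lra.
apply: H => [y z /setD1P[_ yB] /setD1P[_ zB]|y /setD1P[yx yB]]; first exact: hs.
have := hs y x yB xB yx; have := xmin y yB; have := hb y yB.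
move=> /andP[_ ->]; rewrite andbT => h; rewrite ger0_norm; first lra.
by rewrite subr_ge0.
Qed.

Section Boundary.
Local Open Scope ring_scope.
Variables (R : realType) (T : finType) (p : T -> R * R).
Hypothesis psep : forall i j, i != j -> 1 <= sqd (p i) (p j).
Implicit Types (A B C : {set T}).

Local Notation adj := (adj p).
Local Notation ang := (ang p).
Local Notation tau := (tau p).

Definition deg B v := #|[set y in B | adj v y]|.

Definition radj B : rel T := [rel x y | [&& adj x y, x \in B & y \in B]].

Definition biconnected A :=
  forall v x y, v \in A -> x \in A :\ v -> y \in A :\ v -> connect (radj (A :\ v)) x y.

(* Turning from a-b to b-c, all neighbours of b lie on the left of the corner. *)
Definition wall A a b c :=
  [/\ a \in A, b \in A, c \in A, adj b a & adj b c /\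
      {in A, forall y, adj b y -> ang b c y <= ang b c a}].

(** The neighbours of [b] have angles between 0 and that of [a], with [deg A b - 1] gaps of at least
    pi/3. *)
Lemma wall_deg A a b c : wall A a b c -> (deg A b)%:R * (pi / 3) <= ang b c a + pi / 3.
Proof.
case=> aA bA cA ba [bc h]; rewrite /deg.
set N := [set _ in _ | _].
have cN : c \in N by rewrite inE cA.
have := @separated_card _ _ (ang b c) (pi / 3) #|N|.-1 N 0 (ang b c a).
have N0 : (0 < #|N|)%N by apply/card_gt0P; exists c.
rewrite prednK// subr0 => /(_ erefl).
have : #|N|%:R = #|N|.-1%:R + 1 :> R by rewrite natr1 prednK.
move=> -> H; rewrite mulrDl mul1r lerD2r; apply: H.
  move=> x y; rewrite !inE => /andP[_ bx] /andP[_ by_] xy.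
  exact: ang_sep.
move=> x; rewrite inE => /andP[xA bx]; rewrite h// andbT.
by have /andP[] := ang_bounds bc bx.
Qed.

(** * The rightmost walk in a set without cut vertices *)

Section Biconnected.
Variable A : {set T}.
Hypothesis A3 : (2 < #|A|)%N.
Hypothesis Abi : biconnected A.

(** After removing [a], the vertex [v] is still connected to a third vertex; the first step of the
    path is the desired neighbour. *)
Lemma nbr_avoid v a : v \in A -> a \in A -> a != v -> exists b, [/\ b \in A, adj v b & b != a].
Proof.
move=> vA aA av.
have /card_gt0P[y] : (0 < #|A :\ a :\ v|)%N.
  have := cardsD1 a A; have := cardsD1 v (A :\ a); move: A3.
  by case: (a \in A); case: (v \in A :\ a) => /=; lia.
rewrite !inE => /and3P[yv ya yA].
have /connectP[[|b q]] : connect (radj (A :\ a)) v y.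
  by apply: Abi; rewrite // !inE ?(eq_sym v) ?av ?ya.
  by move=> _ yE; rewrite yE eqxx in yv.
move=> /= /andP[/and3P[vb _]]; rewrite !inE => /andP[ba bA] _ _.
by exists b.
Qed.

(** [c] is the first neighbour counterclockwise from the backward direction, which is the sharpest
    right turn. *)
Lemma next_wall a b : a \in A -> b \in A -> adj a b ->
  exists c, wall A a b c /\ c != a.
Proof.
move=> aA bA ab; have ba : adj b a by rewrite adj_sym.
have [c0 [c0A bc0 c0a]] := nbr_avoid bA aA (adj_neq ab).
pose P := [pred c | [&& c \in A, adj b c & c != a]].
have P0 : P c0 by rewrite /P /= c0A bc0.
case: (@Order.TotalTheory.arg_minP _ _ T c0 P (ang b a) P0).
move=> c /and3P[cA bc ca] cmin; exists c; split=> //; split=> //; split=> // y yA by_.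
have [->//|ya] := eqVneq y a.
have h1 : ang b a c <= ang b a y by apply: cmin; rewrite /P /= yA by_.
have h2 : 0 < ang b a c.
  have := ang_neq psep ba bc ba ca; rewrite ang_self// => h.
  by have /andP[h0 _] := ang_bounds ba bc; rewrite lt_neqAle eq_sym h.
have /andP[_ h3] := ang_bounds ba by_.
rewrite /ang (@ccw_rebase _ (p a - p b) (p c - p b) (p y - p b)) ?adj_gt0//.
rewrite (@ccw_rebase _ (p a - p b) (p c - p b) (p a - p b)) ?adj_gt0//.
rewrite -/(ang b a c) -/(ang b a y) -/(ang b a a) h1 ang_self//.
by rewrite (lt_geF h2); move: h3; lra.
Qed.

(** The rightmost walk is extended until its next vertex [c] has occurred before: [l1] leads to the
    cycle formed by [c] and [l2]. The walk never turns back, so the cycle has at least three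
    vertices. *)
Lemma walk_closes v0 x1 : v0 \in A -> x1 \in A -> adj v0 x1 ->
  exists l1 c l2, [/\ uniq (l1 ++ c :: l2), sorted adj (l1 ++ c :: rcons l2 c),
    {subset l1 ++ c :: l2 <= A}, triple_all (wall A) (l1 ++ c :: rcons l2 c) &
    (1 < size l2)%N /\ exists t, l1 ++ c :: l2 = v0 :: x1 :: t].
Proof.
move=> v0A x1A v01.
(* The walk so far is [l], [a], [b]. If the fuel [n] ran out, this simple walk would have more than
   |A| vertices. *)
suff H : forall n l a b, (#|A| <= n + size l)%N -> uniq (rcons (rcons l a) b) ->
    sorted adj (rcons (rcons l a) b) -> {subset rcons (rcons l a) b <= A} ->
    triple_all (wall A) (rcons (rcons l a) b) ->
    (exists t, rcons (rcons l a) b = v0 :: x1 :: t) ->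
    exists l1 c l2, [/\ uniq (l1 ++ c :: l2), sorted adj (l1 ++ c :: rcons l2 c),
      {subset l1 ++ c :: l2 <= A}, triple_all (wall A) (l1 ++ c :: rcons l2 c) &
      (1 < size l2)%N /\ exists t, l1 ++ c :: l2 = v0 :: x1 :: t].
  apply: (H #|A| [::] v0 x1) => //=.
  - by rewrite addn0.
  - by rewrite inE (adj_neq v01).
  - by rewrite v01.
  - by move=> y; rewrite !inE => /orP[]/eqP->.
  - by exists [::].
elim=> [|n IH] l a b hn ul sl lA wl [t ht].
  have : (size (rcons (rcons l a) b) <= #|A|)%N.
    rewrite -(card_uniqP ul); apply: subset_leq_card; apply/subsetP => y; exact: lA.
  by move: hn; rewrite !size_rcons; lia.
have aA : a \in A by apply: lA; rewrite !(mem_rcons, inE) eqxx orbT.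
have bA : b \in A by apply: lA; rewrite !(mem_rcons, inE) eqxx.
have ab : adj a b.
  move: sl; rewrite -!cats1 -catA /=; case: (l) => [|d l'] /=; first by case/andP.
  by rewrite cat_path /= => /and4P[].
have [c [wc ca]] := next_wall aA bA ab.
have bc : adj b c by case: wc => _ _ _ _ [].
have cA : c \in A by case: wc.
set L := rcons (rcons l a) b in ul sl lA wl ht *.
have lastL : last v0 (x1 :: t) = b.
  by have := last_rcons v0 (rcons l a) b; rewrite -/L ht.
have sL : sorted adj (rcons L c).
  rewrite ht -[sorted _ _]/(path adj v0 (rcons (x1 :: t) c)) rcons_path lastL bc andbT.
  by rewrite ht in sl.
have wL : triple_all (wall A) (rcons L c).
  rewrite /L -!cats1 -!catA /=; apply: triple_all_cat => //.
  by move: wl; rewrite /L -!cats1 -!catA.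
have [cL|cL] := boolP (c \in L).
  have LE : L = rcons (rcons l a) b by [].
  case/splitPr : cL ul sl lA wl ht sL wL LE => l1 l2 ul sl lA wl ht sL wL LE.
  exists l1, c, l2; rewrite -rcons_cons -rcons_cat; split => //; split; last by exists t.
  case/lastP: l2 {ul sl lA wl ht sL wL} LE => [|l2 d].
    by rewrite cats1 => /rcons_inj[_ cb]; have := adj_neq bc; rewrite cb eqxx.
  case/lastP: l2 => [|l2 e]; last by rewrite !size_rcons.
  move=> LE; have : rcons (rcons l1 c) d = rcons (rcons l a) b by rewrite -LE -!cats1 -catA.
  by move=> /rcons_inj[/rcons_inj[_ e] _]; rewrite e eqxx in ca.
apply: (IH (rcons l a) b c) => //.
- by rewrite size_rcons addnS -addSn.
- by rewrite rcons_uniq cL.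
- by move=> y; rewrite mem_rcons inE => /predU1P[->|/lA].
- by exists (rcons t c); rewrite -/L ht.
Qed.

Lemma radj_path B x q : path (radj B) x q -> path adj x q /\ {subset q <= B}.
Proof.
elim: q x => [//|y q IH] x /= /andP[/and3P[xy _ yB] /IH[-> qB]].
by rewrite xy; split => // z; rewrite inE => /predU1P[->|/qB].
Qed.

(** Either [y] is on the cycle and the ear is a single edge, or a path avoiding [c] joins [y] to the
    cycle, since [c] is no cut vertex. It is cut at its first cycle vertex [w] and made simple. *)
Lemma ear_exists c l y : uniq (c :: l) -> {subset c :: l <= A} -> y \in A ->
  y != c -> adj c y -> (0 < size l)%N ->
  exists s1 w s2 r, [/\ l = s1 ++ w :: s2, uniq (c :: l ++ r),
    path adj c (rcons r w), {subset r <= A} & head w r = y].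
Proof.
move=> ul lA yA yc cy l0; have [yl|yl] := boolP (y \in l).
  case/splitPr: yl ul {lA l0} => s1 s2 ul; exists s1, y, s2, [::].
  by rewrite cats0; split => //=; rewrite cy.
have fl : head y l \in l by case: (l) l0 => //= f l' _; rewrite mem_head.
have cl : c \notin l by case/andP: ul.
have ul' : uniq l by case/andP: ul.
have fc : head y l != c by apply: contraNneq cl => <-.
have /connectP[q pq fE] : connect (radj (A :\ c)) y (head y l).
  by apply: Abi; rewrite ?lA ?mem_head// !inE ?yc ?yA ?fc//= lA// inE fl orbT.
have hq : has (mem l) q.
  case/lastP: q fE {pq} => [/= fE|q z]; first by rewrite -fE fl in yl.
  by rewrite last_rcons => fE; rewrite has_rcons /= -fE fl.
case: (split_find hq) pq => w s1' s2' wl hs1.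
rewrite cat_path => /andP[pq _].
have lq : last y (rcons s1' w) = w by rewrite last_rcons.
case/shortenP: pq lq => q' pq' uq sub lq.
case/lastP: q' => [|r' w'] in lq pq' uq sub *.
  by move: yl; rewrite (lq : y = w); move: wl => /= ->.
rewrite last_rcons in lq; subst w'.
have [pr rB] := radj_path pq'.
have hr x : x \in r' -> [/\ x \in A, x != c & x \notin l].
  move=> xr; have xq : x \in rcons r' w by rewrite mem_rcons inE xr orbT.
  have := rB x xq; rewrite !inE => /andP[xc xA]; split => //.
  have : x \in rcons s1' w by apply: sub.
  rewrite mem_rcons inE => /predU1P[xw|xs].
    by move: uq => /= /andP[_]; rewrite rcons_uniq -xw xr.
  by apply: contra hs1 => xl; apply/hasP; exists x.
have ur : uniq (c :: l ++ y :: r').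
  rewrite cons_uniq; apply/andP; split.
    by rewrite mem_cat inE !negb_or cl (eq_sym c) yc /=; apply/negP => /hr[_]; rewrite eqxx.
  rewrite cat_uniq ul' /= negb_or yl /=.
  move: uq; rewrite /= mem_rcons inE negb_or rcons_uniq => /andP[/andP[_ ->] /andP[_ ->]].
  by rewrite !andbT; apply/hasPn => x /hr[_ _].
case/splitPr: wl ur {ul lA l0 yl fl cl ul' fc fE hq hs1 hr sub} => s1 s2 ur.
exists s1, w, s2, (y :: r'); split => //; first by rewrite /= cy.
move=> x; rewrite inE => /predU1P[->//|xr].
have : x \in rcons r' w by rewrite mem_rcons inE xr orbT.
by move/rB; rewrite inE => /andP[].
Qed.

Lemma triple_all_corner (P : T -> T -> T -> Prop) a l w b s :
  triple_all P (a :: l ++ w :: rcons s b) -> P (last a l) w (head b s).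
Proof.
rewrite -cat_cons lastI cat_rcons.
have -> : rcons s b = head b s :: behead (rcons s b) by case: s.
exact: triple_all_mid.
Qed.

(* An edge on the right of the corner at c would extend to an ear that comes back
   to the cycle on its right, where all the other corners have no edge. *)
Lemma right_empty c l : uniq (c :: l) -> cycle adj (c :: l) -> (1 < size l)%N ->
  {subset c :: l <= A} -> triple_all (wall A) (c :: rcons l c) ->
  {in A, forall y, adj c y -> ang c (head c l) y <= ang c (head c l) (last c l)}.
Proof.
move=> ul cl l2 lA wl y yA cy; rewrite leNgt; apply/negP => yz.
have cf : adj c (head c l).
  by move: cl l2 => /=; case: (l) => //= f l' /andP[].
have cz : adj c (last c l) by move: cl; rewrite /= rcons_path adj_sym => /andP[].
have yc : y != c by rewrite eq_sym (adj_neq cy).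
have yf : y != head c l.
  by apply: contraTneq yz => ->; rewrite ang_self// -leNgt; case/andP: (ang_bounds cf cz).
have ynz : y != last c l by apply: contraTneq yz => ->; rewrite ltxx.
have [s1 [w [s2 [r [lE ur pr rA ry]]]]] := ear_exists ul lA yA yc cy (ltnW l2).
rewrite lE in ul cl l2 lA wl yz cf cz yf ynz ur.
have hfE : head c (s1 ++ w :: s2) = head w s1 by case: (s1).
have zE : last c (s1 ++ w :: s2) = last w s2 by rewrite last_cat.
rewrite hfE zE in yz yf cf cz ynz.
have z1 : (0 < size r + size s1)%N.
  by case: (r) ry => //= wy; case: (s1) yf => //=; rewrite wy eqxx.
have z2 : (0 < size r + size s2)%N.
  by case: (r) ry => //= wy; case: (s2) ynz => //=; rewrite wy eqxx.
have z3 : (0 < size s1 + size s2)%N by move: l2; rewrite size_cat /= addnS ltnS.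
have := ear_side psep ur cl pr z1 z2 z3; rewrite ry (lt_geF yz) => /esym/negP; apply.
move: wl; rewrite rcons_cat rcons_cons => /triple_all_corner [_ _ _ _ [_]]; apply.
  case/lastP: (r) rA ry => [|r' x] /=; first by move=> _ _; apply: lA; rewrite mem_head.
  by rewrite last_rcons => rA _; apply: rA; rewrite mem_rcons mem_head.
by move: pr; rewrite rcons_path adj_sym => /andP[].
Qed.

(** The walk starts at a vertex farthest from the origin, along the edge of least angle against the
    inward direction. It closes at its start, and the order of its first and last edge there makes
    the total turn positive. *)
Lemma outer_cycle : exists c l, [/\ uniq (c :: l), cycle adj (c :: l),
  (1 < size l)%N, {subset c :: l <= A} &
  triple_all (wall A) (close_up (c :: l)) /\ triple_sum tau (close_up (c :: l)) = 2 * pi].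
Proof.
have /card_gt0P[i0 i0A] : (0 < #|A|)%N by apply: leq_trans A3.
case: (@Order.TotalTheory.arg_maxP _ _ T i0 (mem A) (fun y => dot (p y) (p y)) i0A).
move=> v vA vmax; pose m := - p v.
have vA' : v \in A by [].
have hm y : y \in A -> y != v -> 0 < dot m (p y - p v).
  move=> yA yv; have := vmax y yA; have := psep yv; rewrite /m /sqd /dot /=; lra.
have /card_gt0P[u] : (0 < #|A :\ v|)%N by move: A3; rewrite (cardsD1 v) vA'; case: #|_|.
rewrite !inE => /andP[uv uA].
have [b0 [b0A vb0 _]] := nbr_avoid vA' uA uv.
pose P := [pred b | (b \in A) && adj v b].
have P0 : P b0 by rewrite /P /= b0A.
case: (@Order.TotalTheory.arg_minP _ _ T b0 P (fun y => turn m (p y - p v)) P0).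
move=> x1 /andP[x1A vx1] x1min.
have [l1 [c [l2 [ul sl lA wl [l2s [t lt]]]]]] := walk_closes vA' x1A vx1.
have uc : uniq (c :: l2) by move: ul; rewrite cat_uniq => /and3P[].
have cc : cycle adj (c :: l2) by have [] := cat_sorted2 sl.
have cA : {subset c :: l2 <= A} by move=> y yc; apply: lA; rewrite mem_cat yc orbT.
have wc := triple_all_catr wl.
have re := right_empty uc cc l2s cA wc.
have cf : adj c (head c l2) by move: cc l2s => /=; case: (l2) => //= f l' /andP[].
have cz : adj c (last c l2) by move: cc; rewrite /= rcons_path adj_sym => /andP[].
have zl : last c l2 \in l2 by case: (l2) l2s => //= f l' _; rewrite mem_last.
(* If the walk entered its cycle at [c] from outside, from [y], then both [y] and the last cycle
   vertex would have the largest angle at [c], although distinct neighbours have distinct angles. *)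
case/lastP: l1 => [|l1 y] in ul sl lA wl lt *; last first.
  have [yA _ _ cy [_ h]] : wall A y c (head c l2).
    move: wl; rewrite cat_rcons.
    have -> : rcons l2 c = head c l2 :: behead (rcons l2 c) by case: (l2) l2s.
    exact: triple_all_mid.
  have : y != last c l2.
    apply/eqP => yz; move: ul; rewrite cat_uniq => /and3P[_ /hasPn/(_ y) h' _].
    by move: h'; rewrite /= mem_rcons mem_head yz inE zl orbT => /(_ isT).
  move=> /(ang_neq psep cf cy cz) /negP; case.
  by rewrite eq_le re// h// cA// inE zl orbT.
clear ul sl lA wl; case: lt => cv l2E; subst c.
exists v, l2; split=> //; split.
  have wz : wall A (last v l2) v (head v l2).
    by split=> //; apply: cA; rewrite inE ?zl ?orbT// l2E mem_head orbT.
  have -> : close_up (v :: l2) = rcons (v :: l2) v ++ [:: head v l2].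
    by rewrite /close_up l2E -cats1 -catA /= take0.
  case/lastP: (l2) wc wz => [|l3 z]; first by rewrite l2E in l2s *.
  rewrite last_rcons => wc wz.
  have -> : rcons (v :: rcons l3 z) v ++ [:: head v (rcons l3 z)] =
    (v :: l3) ++ z :: v :: [:: head v (rcons l3 z)] by rewrite -!cats1 /= -!catA.
  by apply: triple_all_cat; [move: wc; rewrite -!cats1 /= -!catA|split].
(* By the choice of [x1], no edge at [v] lies clockwise of the first one, so the first and last edge
   have positive cross product. *)
rewrite (hopf_cycle psep uc cc l2s (m := m)); last first.
  move=> y yl; apply: hm; first by apply: cA; rewrite inE yl orbT.
  by apply: contraTneq yl => ->; case/andP: uc.
set e := p (head v l2) - p v; set f := p (last v l2) - p v.
have he : 0 < dot m e.
  by apply: hm; [apply: cA; rewrite inE l2E mem_head orbT|rewrite eq_sym (adj_neq cf)].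
have hf : 0 < dot m f.
  by apply: hm; [apply: cA; rewrite inE zl orbT|rewrite eq_sym (adj_neq cz)].
have ee : dot e e = 1 by apply/eqP.
have ff : dot f f = 1 by apply/eqP.
have ef : dot e f <= 2^-1.
  apply: adj_dot => //; case: (l2) uc l2s => [//|a [//|b q]] /= /and3P[_ aq _] _.
  by apply: contraNneq aq => ->; exact: mem_last.
have c0 := crs_neq0_half ee ff ef he hf.
rewrite lt_neqAle eq_sym c0 -turn_ge0 ?ee ?ff//.
rewrite (turn_half_sub he hf) subr_ge0.
have -> : e = p x1 - p v by rewrite /e l2E.
by rewrite x1min// /P /= cA ?cz// inE zl orbT.
Qed.

(** Summing the bounds pi - (deg - 1) pi/3 on the turns against the total 2 pi gives the degree
    estimate. The last estimate counts the two cycle neighbours of each vertex. *)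
Lemma boundary_cycle : exists C, [/\ C \subset A, (2 < #|C|)%N,
  (\sum_(v in C) deg A v + 6 <= 4 * #|C|)%N &
  (2 * #|C| <= \sum_(v in C) deg C v)%N].
Proof.
have [c [l [ul cl l2 lA [wl tl]]]] := outer_cycle.
pose C := [set x in c :: l].
have CE : #|C| = size (c :: l) by rewrite cardsE; apply/card_uniqP.
have bigC (F : T -> nat) : (\sum_(v in C) F v = \sum_(v <- c :: l) F v)%N.
  by rewrite (big_uniq _ ul); apply: eq_bigl => x; rewrite inE.
exists C; split.
- by apply/subsetP => x; rewrite inE; apply: lA.
- by rewrite CE /= ltnS.
- have p0 := pi_gt0 R.
  have : triple_sum tau (close_up (c :: l)) <=
      triple_sum (fun _ b _ => pi - ((deg A b)%:R - 1) * (pi / 3)) (close_up (c :: l)).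
    apply: triple_sum_le; apply: triple_all_imp wl => a b d w.
    by rewrite tau_ang; have := wall_deg w; lra.
  rewrite tl triple_sum_close_up_mid; last by rewrite /= ltnS (ltnW l2).
  rewrite bigC sumrB -mulr_suml sumrB !big_const_seq !count_predT !iter_addr_0 -CE.
  rewrite -natr_sum -(mulr_natl pi); set N := #|C|; set D := (\sum_(_ <- _) _)%N.
  move=> h; have : 0 <= pi * (4 * N%:R - D%:R - 6) :> R by lra.
  rewrite pmulr_rge0// => h'; have {h'} : D%:R + 6%:R <= 4%:R * N%:R :> R by lra.
  by rewrite -natrM -natrD ler_nat.
- rewrite mulnC -sum_nat_const; apply: leq_sum => v; rewrite inE => vs.
  case: (rot_to vs) => i l' rl.
  have ul' : uniq (v :: l') by rewrite -rl rot_uniq.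
  have cl' : cycle adj (v :: l') by rewrite -rl rot_cycle.
  have sl' : (1 < size l')%N by rewrite -ltnS -[(size l').+1]/(size (v :: l')) -rl size_rot.
  have hz : head v l' != last v l'.
    case: (l') ul' sl' => [//|a [//|b q]] /= /and3P[_ aq _] _.
    by apply: contraNneq aq => ->; exact: mem_last.
  have := cards2 (head v l') (last v l'); rewrite hz => <-; apply: subset_leq_card.
  have memC x : (x \in C) = (x \in v :: l') by rewrite in_set -rl mem_rot.
  apply/subsetP => x /set2P[]->; rewrite in_set memC; apply/andP; split.
  + by rewrite inE; case: (l') sl' => //= f q _; rewrite mem_head orbT.
  + by move: cl' sl' => /=; case: (l') => //= f q /andP[].
  + exact: mem_last.
  + by move: cl'; rewrite /= rcons_path adj_sym => /andP[].
Qed.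

End Biconnected.
End Boundary.

(** For the deficits s = 6 n - E, gluing at one vertex gives s = s1 + s2 - 6. As n1, n2 >= 2 force
    s1, s2 >= 10, the slack 2 (s1 - 6) (s2 - 6) is at least 32. *)
Lemma glue_arith n1 n2 n E1 E2 E : (n1 + n2 = n + 1)%N -> (E1 + E2 = E)%N ->
  (E1 <= 6 * n1)%N -> (E2 <= 6 * n2)%N -> (1 < n1)%N -> (1 < n2)%N ->
  (48 * n1 <= (6 * n1 - E1) ^ 2 + 12)%N -> (48 * n2 <= (6 * n2 - E2) ^ 2 + 12)%N ->
  (E <= 6 * n)%N /\ (48 * n + 32 <= (6 * n - E) ^ 2 + 12)%N.
Proof.
move=> hn hE le1 le2 h1 h2.
set s1 := (6 * n1 - E1)%N; set s2 := (6 * n2 - E2)%N => b1 b2.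
have t1 : (9 < s1)%N by rewrite ltnNge; apply/negP => h; nia.
have t2 : (9 < s2)%N by rewrite ltnNge; apply/negP => h; nia.
have -> : (6 * n - E = (s1 - 10) + (s2 - 10) + 14)%N by lia.
split; first by lia.
have e1 : s1 = (s1 - 10 + 10)%N by lia.
have e2 : s2 = (s2 - 10 + 10)%N by lia.
move: b1 b2; rewrite {}[in X in X -> _]e1 {}[in X in _ -> X -> _]e2; nia.
Qed.

(** [b] boundary vertices have degree sum [D] and [F] ordered bonds among themselves; [M] is the
    degree sum of the rest. The deficits satisfy s >= 2 b + 6 and s >= s' + 12, and 24 (s - 6) + (s
    - 12)^2 = s^2. *)
Lemma peel_arith n b n' D E F E' M : (n = b + n')%N -> (D + 6 <= 4 * b)%N ->
  (2 * b <= F)%N -> (E + F = E' + 2 * D)%N -> (E = D + M)%N -> (M <= 6 * n')%N ->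
  (E' <= 6 * n')%N -> (48 * n' <= (6 * n' - E') ^ 2 + 12)%N ->
  (E <= 6 * n)%N /\ (48 * n <= (6 * n - E) ^ 2 + 12)%N.
Proof.
move=> hn hD hF hE hM M6 le' b'.
have lE : (E <= 6 * n)%N by lia.
split=> //.
have h1 : (2 * b + 6 <= 6 * n - E)%N by lia.
have h2 : (6 * n' - E' + 12 <= 6 * n - E)%N by lia.
move: h1 h2 b'; set s := (6 * n - E)%N; set s' := (6 * n' - E')%N => h1 h2 b'.
have [t st] : exists t, s = (t + 12)%N by exists (s - 12)%N; lia.
have : (s' ^ 2 <= t ^ 2)%N by rewrite leq_exp2r; lia.
by rewrite st; nia.
Qed.

(** Now s = 12 k + 18, so b <= 6 k + 6 and s' <= 12 k + 6. The bound on n' from s' gives the reverse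
    inequality for b, and all estimates become equalities. *)
Lemma peel_arith_eq k n b n' D E F E' M : (n = b + n')%N -> (D + 6 <= 4 * b)%N ->
  (2 * b <= F)%N -> (E + F = E' + 2 * D)%N -> (E = D + M)%N -> (M <= 6 * n')%N ->
  (E' <= 6 * n')%N -> (48 * n' <= (6 * n' - E') ^ 2 + 12)%N ->
  n = (3 * k.+1 * k.+2 + 1)%N -> (E = 6 * n - (12 * k.+1 + 6))%N ->
  [/\ n' = (3 * k * k.+1 + 1)%N, (E' = 6 * n' - (12 * k + 6))%N & M = (6 * n')%N].
Proof.
move=> hn hD hF hE hM M6 le' b' nk Ek.
have lE : (12 * k.+1 + 6 <= 6 * n)%N by rewrite nk; nia.
have h1 : (b <= 6 * k + 6)%N by lia.
have h2 : (6 * n' - E' <= 12 * k + 6)%N by lia.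
have h3 : ((6 * n' - E') ^ 2 <= (12 * k + 6) ^ 2)%N by rewrite leq_exp2r.
have h4 : (48 * n' <= 144 * k * k + 144 * k + 48)%N by apply: leq_trans b' _; nia.
have hb : b = (6 * k + 6)%N by nia.
have hn' : n' = (3 * k * k.+1 + 1)%N by nia.
have h5 : (12 * k + 6 <= 6 * n' - E')%N.
  rewrite leqNgt; apply/negP => h6.
  have : ((6 * n' - E') ^ 2 <= (12 * k + 5) ^ 2)%N by rewrite leq_exp2r; lia.
  by nia.
by split => //; lia.
Qed.

(** * The bond bound *)

Section Bound.
Local Open Scope ring_scope.
Variables (R : realType) (T : finType) (p : T -> R * R).
Hypothesis psep : forall i j, i != j -> 1 <= sqd (p i) (p j).
Implicit Types (A B C : {set T}).

Local Notation adj := (adj p).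
Local Notation ang := (ang p).
Local Notation deg := (deg p).

(* Ordered pairs, so that bonds A A counts every bond twice. *)
Definition bonds A B := (\sum_(x in A) \sum_(y in B) adj x y)%N.

Lemma degE B v : deg B v = (\sum_(y in B) adj v y)%N.
Proof.
rewrite /deg -sum1dep_card big_mkcondr /=; apply: eq_bigr => y _.
by case: (adj v y).
Qed.

Lemma bonds_deg A : bonds A A = (\sum_(v in A) deg A v)%N.
Proof. by apply: eq_bigr => v _; rewrite degE. Qed.

Lemma bondsC A B : bonds A B = bonds B A.
Proof.
rewrite /bonds exchange_big; apply: eq_bigr => x _; apply: eq_bigr => y _.
by rewrite adj_sym.
Qed.

Lemma bonds_setDl A B C : C \subset A -> (bonds A B = bonds C B + bonds (A :\: C) B)%N.
Proof. by move=> CA; rewrite /bonds (big_setID C) /= (setIidPr CA). Qed.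

Lemma bonds_setDr A B C : C \subset A -> (bonds B A = bonds B C + bonds B (A :\: C))%N.
Proof. by move=> CA; rewrite !(bondsC B) -bonds_setDl. Qed.

Lemma bonds_setU1 v B : v \notin B ->
  (bonds (v |: B) (v |: B) = bonds B B + 2 * bonds [set v] B)%N.
Proof.
move=> vB; have XE : (v |: B) :\: [set v] = B by rewrite setU1K.
have v0 : bonds [set v] [set v] = 0%N.
  by rewrite /bonds !big_set1; apply/eqP; rewrite eqb0; apply/negP => /adj_neq; rewrite eqxx.
have sv : [set v] \subset v |: B by rewrite subsetUl.
rewrite (bonds_setDl _ sv) !(bonds_setDr _ sv) XE v0 (bondsC B).
by rewrite mul2n -addnn add0n addnCA addnC -addnA addnC.
Qed.

Lemma deg_le6 A v : (deg A v <= 6)%N.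
Proof.
rewrite /deg; set N := [set _ in _ | _].
have [->|/set0Pn[c cN]] := eqVneq N set0; first by rewrite cards0.
have vc : adj v c by move: cN; rewrite inE => /andP[].
case: (@Order.TotalTheory.arg_maxP _ _ T c (mem N) (ang v c) cN) => y yN ymax.
have vy : adj v y by have : y \in N by []; rewrite inE => /andP[].
have N0 : (0 < #|N|)%N by apply/card_gt0P; exists c.
have := @separated_card _ _ (ang v c) (pi / 3) #|N|.-1 N 0 (ang v c y).
rewrite prednK// subr0 => /(_ erefl) H.
have {}H : #|N|.-1%:R * (pi / 3) <= ang v c y.
  apply: H => [z t|z zN]; last first.
    have -> : ang v c z <= ang v c y by exact: ymax.
    rewrite andbT; move: zN; rewrite inE => /andP[_ vz].
    by have /andP[] := ang_bounds vc vz.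
  by rewrite !inE => /andP[_ vz] /andP[_ vt] zt; apply: ang_sep.
have /andP[_ h] := ang_bounds vc vy.
have p0 := pi_gt0 R.
have : 0 < pi * (6 - #|N|.-1%:R) :> R by lra.
by rewrite pmulr_rgt0// subr_gt0 ltr_nat; case: #|N|.
Qed.

Lemma bonds_le6 A : (bonds A A <= 6 * #|A|)%N.
Proof. by rewrite bonds_deg mulnC -sum_nat_const; apply: leq_sum => v _; exact: deg_le6. Qed.

(** If removing [v] separates [x] from [y], there is no bond between the component [D] of [x] and
    the rest [D']; each of them keeps a copy of [v]. *)
Lemma biconnected_or_glued A : biconnected p A \/ exists A1 A2,
  [/\ (#|A1| + #|A2| = #|A| + 1)%N, (bonds A1 A1 + bonds A2 A2 = bonds A A)%N,
      (1 < #|A1|)%N & (1 < #|A2|)%N].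
Proof.
have [h|] := boolP [forall v in A, [forall x in A :\ v, [forall y in A :\ v,
    connect (radj p (A :\ v)) x y]]].
  left=> v x y vA xA yA.
  by move/forall_inP/(_ v vA)/forall_inP/(_ x xA)/forall_inP/(_ y yA): h.
rewrite negb_forall_in => /exists_inP[v vA]; rewrite negb_forall_in => /exists_inP[x xA].
rewrite negb_forall_in => /exists_inP[y yA] xy; right.
set r := radj p _ in xy; pose D := [set z in A :\ v | connect r x z].
have DA : D \subset A by apply/subsetP => z; rewrite !inE => /andP[/andP[]].
have xD : x \in D by rewrite inE xA connect0.
have vD : v \notin D by rewrite !inE eqxx.
pose D' := (A :\ v) :\: D.
have yD' : y \in D' by rewrite !inE (negbTE xy) andbF /=; move: yA; rewrite !inE.
have vD' : v \notin D' by rewrite !inE eqxx andbF.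
have D0 : bonds D D' = 0%N.
  apply: big1 => a aD; apply: big1 => b; rewrite inE => /andP[bD bA].
  apply/eqP; rewrite eqb0; apply: contra bD => ab; rewrite inE bA.
  move: aD; rewrite inE => /andP[aA /connect_trans]; apply; apply: connect1.
  by apply/and3P; split.
have AE : A = v |: (D :|: D').
  by apply/setP => z; rewrite !inE; case: eqVneq => [->|] //=; case: (z \in A);
    case: connect.
have dD : [disjoint D & D'] by rewrite disjoint_sym disjoints_subset subsetDr.
have DE : (D :|: D') :\: D = D' by rewrite setDUl setDv set0U setDDl setUid.
have cA : #|A| = (#|D| + #|D'|).+1.
  rewrite {1}AE cardsU1 inE negb_or vD vD' add1n cardsU.
  by move: dD; rewrite -setI_eq0 => /eqP ->; rewrite cards0 subn0.
exists (v |: D), (v |: D'); split.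
- by rewrite !cardsU1 vD vD' cA !add1n addSn addnS addn1.
- rewrite [in RHS]AE !bonds_setU1//; last by rewrite inE negb_or vD.
  have sD : D \subset D :|: D' by rewrite subsetUl.
  by rewrite (bonds_setDl _ sD) !(bonds_setDr _ sD) DE D0 (bondsC D') D0 addn0 add0n mulnDr addnACA.
- by rewrite cardsU1 vD; have : (0 < #|D|)%N by [apply/card_gt0P; exists x].
- by rewrite cardsU1 vD'; have : (0 < #|D'|)%N by [apply/card_gt0P; exists y].
Qed.

Lemma bonds_peel A C : C \subset A ->
  (bonds A A + bonds C C = bonds (A :\: C) (A :\: C) + 2 * \sum_(v in C) deg A v)%N.
Proof.
move=> CA; have -> : (\sum_(v in C) deg A v = bonds C A)%N.
  by apply: eq_bigr => v _; rewrite degE.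
by rewrite (bonds_setDl A CA) !(bonds_setDr _ CA) (bondsC (A :\: C) C); lia.
Qed.

Lemma bonds_split A C : C \subset A ->
  (bonds A A = \sum_(v in C) deg A v + \sum_(v in A :\: C) deg A v)%N.
Proof. by move=> CA; rewrite bonds_deg (big_setID C) /= (setIidPr CA). Qed.

Lemma sum_deg_le6 A B : (\sum_(v in B) deg A v <= 6 * #|B|)%N.
Proof. by rewrite mulnC -sum_nat_const; apply: leq_sum => v _; exact: deg_le6. Qed.

Lemma bonds_small A : (#|A| <= 2)%N -> (48 * #|A| <= (6 * #|A| - bonds A A) ^ 2 + 12)%N.
Proof.
move=> A2; have h : (bonds A A <= #|A| * #|A|.-1)%N.
  rewrite bonds_deg -sum_nat_const; apply: leq_sum => v vA.
  rewrite [in X in (_ <= X)%N](cardsD1 v) vA /= /deg; apply: subset_leq_card.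
  by apply/subsetP => y; rewrite !inE => /andP[-> /adj_neq]; rewrite eq_sym => ->.
by case: #|A| A2 h => [|[|[|n]]]; case: (bonds A A) => [|[|[|m]]].
Qed.

Theorem bonds_bound A : (48 * #|A| <= (6 * #|A| - bonds A A) ^ 2 + 12)%N.
Proof.
have [n] := ubnP #|A|; elim: n A => [//|n IH] A An.
have [A2|A3] := leqP #|A| 2; first exact: bonds_small.
have [bi|[A1 [A2 [cA bA A11 A21]]]] := biconnected_or_glued A.
  have [C [CA C3 hD hF]] := boundary_cycle psep A3 bi.
  have cA : #|A| = (#|C| + #|A :\: C|)%N by rewrite -(cardsID C A) (setIidPr CA).
  have cB : (#|A :\: C| < n)%N by move: An; rewrite cA; lia.
  have [] // := peel_arith cA hD _ (bonds_peel CA) (bonds_split CA) (sum_deg_le6 _ _)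
    (bonds_le6 _) (IH _ cB); by rewrite bonds_deg.
have i1 : (#|A1| < n)%N by lia.
have i2 : (#|A2| < n)%N by lia.
have [_] := glue_arith cA bA (bonds_le6 _) (bonds_le6 _) A11 A21 (IH _ i1) (IH _ i2).
by apply: leq_trans; exact: leq_addr.
Qed.

(* At a hexagonal number the bound is attained only through equality in every
   peeling step. *)
Theorem bonds_bound_eq A k : #|A| = (3 * k.+1 * k.+2 + 1)%N ->
  bonds A A = (6 * #|A| - (12 * k.+1 + 6))%N ->
  exists B, [/\ B \subset A, #|B| = (3 * k * k.+1 + 1)%N,
    bonds B B = (6 * #|B| - (12 * k + 6))%N & {in B, forall v, deg A v = 6}].
Proof.
move=> cA bA; have A3 : (2 < #|A|)%N by rewrite cA; lia.
have [bi|[A1 [A2 [c12 b12 A11 A21]]]] := biconnected_or_glued A; last first.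
  (* A cut vertex would leave slack 32 in a bound that is attained. *)
  have [_] := glue_arith c12 b12 (bonds_le6 _) (bonds_le6 _) A11 A21
    (bonds_bound A1) (bonds_bound A2).
  have -> : (6 * #|A| - bonds A A = 12 * k.+1 + 6)%N by rewrite bA cA; nia.
  by rewrite cA; nia.
have [C [CA C3 hD hF]] := boundary_cycle psep A3 bi.
have cD : #|A| = (#|C| + #|A :\: C|)%N by rewrite -(cardsID C A) (setIidPr CA).
have hF' : (2 * #|C| <= bonds C C)%N by rewrite bonds_deg.
have [h1 h2 h3] := peel_arith_eq cD hD hF' (bonds_peel CA) (bonds_split CA)
  (sum_deg_le6 _ _) (bonds_le6 _) (bonds_bound _) cA bA.
exists (A :\: C); split => //; first exact: subsetDl.
(* By [h3] the degrees off the boundary sum to six per vertex, so none is below six. *)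
move=> v vB; apply/eqP; rewrite eqn_leq deg_le6 /= leqNgt; apply/negP => d6.
have : (\sum_(v in A :\: C) deg A v < 6 * #|A :\: C|)%N; last by rewrite h3 ltnn.
rewrite mulnC -sum_nat_const (bigD1 v) //= [ltnRHS](bigD1 v) //=.
by rewrite -addSn leq_add// leq_sum// => w _; exact: deg_le6.
Qed.

Definition rot60 (u : R * R) : R * R :=
  (u.1 / 2 - Num.sqrt 3 / 2 * u.2, u.2 / 2 + Num.sqrt 3 / 2 * u.1).

(** The five other neighbours have angles from [c] in [pi/3, 5 pi/3] with gaps of at least pi/3.
    They span at least 4 pi/3, so the interval is filled and the first of them lies at exactly
    pi/3. *)
Lemma deg6_rot60 A v c : deg A v = 6 -> c \in A -> adj v c ->
  exists y, [/\ y \in A, adj v y & p y = p v + rot60 (p c - p v)].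
Proof.
rewrite /deg; set N := [set _ in _ | _] => N6 cA vc.
have cN : c \in N by rewrite inE cA.
have p0 := pi_gt0 R.
have N5 : #|N :\ c| = 5 by move: N6; rewrite (cardsD1 c) cN => -[].
have /card_gt0P[y0 y0N] : (0 < #|N :\ c|)%N by rewrite N5.
have memN z : z \in N :\ c -> [/\ z \in A, adj v z & z != c].
  by rewrite !inE => /and3P[-> -> ->].
case: (@Order.TotalTheory.arg_maxP _ _ T y0 (mem (N :\ c)) (ang v c) y0N) => y yN ymax.
case: (@Order.TotalTheory.arg_minP _ _ T y0 (mem (N :\ c)) (ang v c) y0N) => x xN xmin.
have [yA vy yc] := memN y yN; have [xA vx xc] := memN x xN.
have h1 : pi / 3 <= ang v c x.
  have := ang_sep psep vc vx vc xc; rewrite ang_self// subr0 ger0_norm//.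
  by have /andP[] := ang_bounds vc vx.
have h2 : ang v c y <= 5 * pi / 3.
  have : pi / 3 <= ang v y c.
    have := ang_sep psep vy vc vy; rewrite ang_self// subr0 eq_sym => /(_ yc).
    by rewrite ger0_norm//; have /andP[] := ang_bounds vy vc.
  have vyp : 0 < ang v c y.
    by have : ang v c x <= ang v c y; [exact: ymax|lra].
  rewrite /ang (@ccw_rebase _ (p c - p v) (p y - p v)) ?adj_gt0//.
  rewrite -/(ang v c y) -/(ang v c c) ang_self// (lt_geF vyp); lra.
have h3 := @separated_card _ _ (ang v c) (pi / 3) 4 (N :\ c) (ang v c x) (ang v c y) N5.
have {}h3 : 4%:R * (pi / 3) <= ang v c y - ang v c x.
  apply: h3 => [z t /memN[_ vz _] /memN[_ vt _] zt|z zN]; first exact: ang_sep.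
  by apply/andP; split; [exact: xmin|exact: ymax].
have {}h1 : ang v c x = pi / 3 by lra.
exists x; split=> //.
have uv : dot (p c - p v) (p c - p v) = 1 by apply/eqP.
have ux : dot (p x - p v) (p x - p v) = 1 by apply/eqP.
have [] := ccw_unit uv ux; rewrite -/(ang v c x) h1 cos_pi3 sin_pi3.
rewrite /rot60; move: uv; rewrite /dot /crs /=; set s := Num.sqrt 3 / 2.
case: (p x) (p v) (p c) => [x1 x2] [v1 v2] [c1 c2] /= uv hd hc.
(* A vector is recovered from its dot and cross product with the unit vector [p c - p v]. *)
have e1 : x1 - v1 = (c1 - v1) / 2 - s * (c2 - v2).
  transitivity (((c1 - v1) * (c1 - v1) + (c2 - v2) * (c2 - v2)) * (x1 - v1)).
    by rewrite uv mul1r.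
  transitivity ((c1 - v1) * ((c1 - v1) * (x1 - v1) + (c2 - v2) * (x2 - v2)) -
    ((c1 - v1) * (x2 - v2) - (c2 - v2) * (x1 - v1)) * (c2 - v2)); first by ring.
  by rewrite hd hc; ring.
have e2 : x2 - v2 = (c2 - v2) / 2 + s * (c1 - v1).
  transitivity (((c1 - v1) * (c1 - v1) + (c2 - v2) * (c2 - v2)) * (x2 - v2)).
    by rewrite uv mul1r.
  transitivity ((c2 - v2) * ((c1 - v1) * (x1 - v1) + (c2 - v2) * (x2 - v2)) +
    ((c1 - v1) * (x2 - v2) - (c2 - v2) * (x1 - v1)) * (c1 - v1)); first by ring.
  by rewrite hd hc; ring.
by congr pair => /=; [rewrite -e1|rewrite -e2]; ring.
Qed.

End Bound.

(** * Triangular lattice and rigidity *)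

Section Lattice.
Local Open Scope ring_scope.
Variable R : realType.
Implicit Types (c u : R * R) (m n a b : int).

Definition lat c u m n : R * R :=
  (c.1 + m%:~R * u.1 + n%:~R * (rot60 u).1, c.2 + m%:~R * u.2 + n%:~R * (rot60 u).2).

(** The hexagon of side k as an intersection of three strips, one for each pair of parallel
    sides. *)
Definition hexcoord (k : nat) m n :=
  [&& - k%:Z <= m, m <= k%:Z, - k%:Z <= n, n <= k%:Z, - k%:Z <= m + n & m + n <= k%:Z].

(** Counterclockwise order: rotation by pi/3 takes (a, b) to (- b, a + b). *)
Definition dirs : seq (int * int) :=
  [:: (1, 0); (0, 1); (-1, 1); (-1, 0); (0, -1); (1, -1)].

Lemma sqrt3_sqr : Num.sqrt 3 * Num.sqrt 3 = 3 :> R.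
Proof. by rewrite -expr2 sqr_sqrtr. Qed.

Lemma lat_sqd c u m n m' n' : dot u u = 1 -> sqd (lat c u m n) (lat c u m' n') =
  ((m' - m) ^+ 2 + (m' - m) * (n' - n) + (n' - n) ^+ 2)%:~R.
Proof.
rewrite /sqd /dot /lat /rot60 /= => uu; have s3 := sqrt3_sqr.
rewrite !(rmorphD, rmorphB, rmorphM, rmorphXn) /=.
set M := m%:~R; set M' := m'%:~R; set N := n%:~R; set N' := n'%:~R.
move: s3 uu; set s := Num.sqrt 3; case: u => u1 u2 /= s3 uu.
transitivity ((u1 * u1 + u2 * u2) * ((M' - M) ^+ 2 + (M' - M) * (N' - N) +
   ((1 + s * s) / 4) * (N' - N) ^+ 2)); first by field.
by rewrite uu s3; field.
Qed.

Lemma lat_rot c u m n a b :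
  let d := lat c u (m + a) (n + b) - lat c u m n in
  lat c u m n + rot60 d = lat c u (m - b) (n + a + b).
Proof.
have s3 := sqrt3_sqr.
rewrite /lat /rot60 /= !(rmorphD, rmorphB) /=.
set M := m%:~R; set N := n%:~R; set X := a%:~R; set Y := b%:~R.
move: s3; set s := Num.sqrt 3 => s3; case: u c => [u1 u2] [c1 c2] /=.
have e2 (z : R) : s * (s * z) = 3 * z by rewrite mulrA s3.
congr pair => /=.
  transitivity (c1 + (M - Y) * u1 + (N + X + Y) * (u1 / 2 - s / 2 * u2) +
    (3 * (Y * u1) - s * (s * (Y * u1))) / 4); first by field.
  by rewrite e2; field.
transitivity (c2 + (M - Y) * u2 + (N + X + Y) * (u2 / 2 + s / 2 * u1) +
  (3 * (Y * u2) - s * (s * (Y * u2))) / 4); first by field.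
by rewrite e2; field.
Qed.

(** Serves twice: it attaches the sites of a new shell to the smaller hexagon, and it gives each
    site off the center a neighbour already known to be occupied. *)
Lemma toward_center (k : nat) m n : hexcoord k.+1 m n -> (m = 0 /\ n = 0) \/
  exists a b, (a, b) \in dirs /\ hexcoord k (m + a) (n + b).
Proof.
rewrite /hexcoord => h.
have [m0|m0] := lerP 0 m; have [n0|n0] := lerP 0 n.
- have [mE|mE] := eqVneq m 0; last by right; exists (-1), 0; split => //; lia.
  have [nE|nE] := eqVneq n 0; first by left.
  by right; exists 0, (-1); split => //; lia.
- have [mE|mE] := eqVneq m 0; last by right; exists (-1), 1; split => //; lia.
  by right; exists 0, 1; split => //; lia.
- have [nE|nE] := eqVneq n 0; last by right; exists 1, (-1); split => //; lia.
  by right; exists 1, 0; split => //; lia.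
- by right; exists 1, 0; split => //; lia.
Qed.

Lemma hexcoord_widen (k : nat) m n : hexcoord k m n -> hexcoord k.+1 m n.
Proof. by rewrite /hexcoord; lia. Qed.

Lemma hexcoord_center (k : nat) : hexcoord k 0 0.
Proof. by rewrite /hexcoord; lia. Qed.

End Lattice.

Section Rigidity.
Local Open Scope ring_scope.
Variables (R : realType) (T : finType) (p : T -> R * R).
Hypothesis psep : forall i j, i != j -> 1 <= sqd (p i) (p j).

Let occupied (A : {set T}) q := exists2 y, y \in A & p y = q.

(** Each occupied direction forces the next one counterclockwise, and these six implications form a
    cycle. *)
Lemma six_neighbours (A : {set T}) v c u (m n a b : int) : dot u u = 1 ->
  deg p A v = 6 -> p v = lat c u m n -> (a, b) \in dirs ->
  occupied A (lat c u (m + a) (n + b)) ->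
  forall a' b', (a', b') \in dirs -> occupied A (lat c u (m + a') (n + b')).
Proof.
move=> uu d6 pv ab.
pose Q a b := occupied A (lat c u (m + a) (n + b)).
rewrite -/(Q a b) => Qab.
have step x y : (x, y) \in dirs -> Q x y -> Q (- y) (x + y).
  move=> xy [z zA pz].
  have vz : adj p v z.
    rewrite /adj pv pz lat_sqd// !(addrC m, addrC n) !addrK; apply/eqP.
    by move: xy; rewrite !inE => /or4P[|||/or3P[]] /eqP[-> ->].
  have [w [wA _ pw]] := deg6_rot60 psep d6 zA vz.
  by exists w => //; rewrite pw pv pz lat_rot addrA.
have h1 : Q 1 0 -> Q 0 1 by exact: (@step 1 0).
have h2 : Q 0 1 -> Q (-1) 1 by exact: (@step 0 1).
have h3 : Q (-1) 1 -> Q (-1) 0 by exact: (@step (-1) 1).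
have h4 : Q (-1) 0 -> Q 0 (-1) by exact: (@step (-1) 0).
have h5 : Q 0 (-1) -> Q 1 (-1) by exact: (@step 0 (-1)).
have h6 : Q 1 (-1) -> Q 1 0 by exact: (@step 1 (-1)).
move=> a' b'; rewrite -/(Q a' b').
have q1 : Q 1 0.
  by move: ab Qab; rewrite !inE => /or4P[|||/or3P[]] /eqP[-> ->]; eauto 10.
by rewrite !inE => /or4P[|||/or3P[]] /eqP[-> ->]; eauto 10.
Qed.

Theorem hexagon_occupied (k : nat) (A : {set T}) :
  #|A| = (3 * k * k.+1 + 1)%N -> bonds p A A = (6 * #|A| - (12 * k + 6))%N ->
  exists c u, dot u u = 1 /\ forall m n, hexcoord k m n -> occupied A (lat c u m n).
Proof.
elim: k A => [|k IH] A cA bA.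
  have /cards1P[a AE] : #|A| == 1%N by rewrite cA.
  exists (p a), (1, 0); split; first by rewrite /dot /=; ring.
  move=> m n h; have [-> ->] : m = 0 /\ n = 0 by move: h; rewrite /hexcoord; lia.
  by exists a; [rewrite AE set11|rewrite /lat !mul0r !addr0; case: (p a)].
have [B [BA cB bB d6]] := bonds_bound_eq psep cA bA.
have [c0 [u0 [uu0 h0]]] := IH B cB bB.
(* The frame is inherited from [B], unless [B] is a single point; then a neighbour of that point
   fixes the direction [u]. *)
have [c [u [uu [h [y yA py]]]]] : exists c u, dot u u = 1 /\
    (forall m n, hexcoord k m n -> occupied B (lat c u m n)) /\ occupied A (lat c u 1 0).
  case: k {IH cA bA bB} cB h0 => [|k] cB h0; last first.
    exists c0, u0; split=> //; split=> //.
    by have [|y yB] := h0 1 0; [rewrite /hexcoord; lia|exists y => //; apply: (subsetP BA)].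
  have /cards1P[b BE] : #|B| == 1%N by rewrite cB.
  have /card_gt0P[y] : (0 < deg p A b)%N by rewrite d6// BE set11.
  rewrite inE => /andP[yA bY]; exists (p b), (p y - p b); split; first exact/eqP.
  split=> [m n h|].
    have [-> ->] : m = 0 /\ n = 0 by move: h; rewrite /hexcoord; lia.
    by exists b; [rewrite BE set11|rewrite /lat !mul0r !addr0; case: (p b)].
  exists y => //; rewrite /lat !mul0r !mul1r !addr0 /=.
  by case: (p y) (p b) => [y1 y2] [b1 b2] /=; congr pair; ring.
exists c, u; split=> // m n hmn.
(* A site of the smaller hexagon has six neighbours, so one occupied adjacent site yields all of
   them. *)
have key m' n' a b : hexcoord k m' n' -> (a, b) \in dirs ->
    occupied A (lat c u (m' + a) (n' + b)).
  move=> h' ab; have [v vB pv] := h _ _ h'.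
  suff [a0 [b0 [ab0 o]]] : exists a0 b0, (a0, b0) \in dirs /\
      occupied A (lat c u (m' + a0) (n' + b0)).
    exact: (six_neighbours uu (d6 v vB) pv ab0 o).
  case: k {IH cA bA bB cB h0 d6 hmn} h h' => [|k] h h'.
    exists 1, 0; split=> //; have [-> ->] : m' = 0 /\ n' = 0 by move: h'; rewrite /hexcoord; lia.
    by exists y.
  have [[-> ->]|[a0 [b0 [ab0 h0]]]] := toward_center h'; first by exists 1, 0; split=> //; exists y.
  exists a0, b0; split=> //; have [w wB pw] := h _ _ (hexcoord_widen h0).
  by exists w => //; apply: (subsetP BA).
have [[-> ->]|[a [b [ab h']]]] := toward_center hmn.
  by have [w wB pw] := h 0 0 (hexcoord_center k); exists w => //; apply: (subsetP BA).
have ab' : (- a, - b) \in dirs by move: ab; rewrite !inE => /or4P[|||/or3P[]] /eqP[-> ->].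
by have := key _ _ _ _ h' ab'; rewrite !addrK.
Qed.

End Rigidity.

(** * Counting points and bonds of the hexagon *)

Section HexagonCount.
Variable k : nat.
Notation I := 'I_(2 * k).+1.

(* Lattice coordinates shifted by k. *)
Definition hexset : {set I * I} := [set v : I * I | k <= v.1 + v.2 <= 3 * k].

Lemma hexsetE (v : I * I) :
  (v \in hexset) = hexcoord k (v.1%:Z - k%:Z)%R (v.2%:Z - k%:Z)%R.
Proof. by case: v => [[i hi] [j hj]]; rewrite inE /hexcoord /=; lia. Qed.

Lemma hexcoord_hexset (m n : int) : hexcoord k m n ->
  exists2 v : I * I, v \in hexset & (m = v.1%:Z - k%:Z /\ n = v.2%:Z - k%:Z)%R.
Proof.
rewrite /hexcoord => h.
have hi : (absz (m + k%:Z)%R < (2 * k).+1)%N by lia.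
have hj : (absz (n + k%:Z)%R < (2 * k).+1)%N by lia.
exists (Ordinal hi, Ordinal hj); first by rewrite inE /=; lia.
by split => /=; lia.
Qed.

Lemma sum_interval a b N : \sum_(0 <= j < N) (a <= j < b) = minn b N - a.
Proof.
elim: N => [|N IH]; first by rewrite big_geq// minn0 sub0n.
by rewrite big_nat_recr//= IH; case: (a <= N < b) / boolP => /=; lia.
Qed.

Lemma card_hexset : #|hexset| = 3 * k * k.+1 + 1.
Proof.
have -> : #|hexset| = \sum_(0 <= i < (2 * k).+1) \sum_(0 <= j < (2 * k).+1)
    (k - i <= j < (3 * k).+1 - i).
  rewrite -sum1dep_card big_mkcond /= -(pair_bigA _ (fun (i j : I) =>
    if k <= i + j <= 3 * k then 1 else 0)) /= big_mkord; apply: eq_bigr => i _.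
  rewrite big_mkord; apply: eq_bigr => j _.
  by have := ltn_ord i; case: ifP => h ?; case: (_ <= _ < _) / boolP => h' //=; lia.
under eq_bigr do rewrite sum_interval.
rewrite (@big_cat_nat _ _ _ k.+1)//=; last lia.
(* Row i has k + 1 + i sites for i <= k and 3 k + 1 - i sites beyond; the factor 2 avoids division
   in the arithmetic series. *)
have low t : t <= k.+1 ->
    2 * \sum_(0 <= i < t) (minn ((3 * k).+1 - i) (2 * k).+1 - (k - i)) = t * (2 * k + 1 + t).
  elim: t => [|t IH] tk; first by rewrite big_geq.
  by rewrite big_nat_recr//= mulnDr IH; [nia|lia].
have high t : t <= k ->
    2 * \sum_(k.+1 <= i < k.+1 + t) (minn ((3 * k).+1 - i) (2 * k).+1 - (k - i)) =
    t * (4 * k + 1 - t).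
  elim: t => [|t IH] tk; first by rewrite addn0 big_geq.
  by rewrite addnS big_nat_recr ?leq_addr//= mulnDr IH; [nia|lia].
have := low k.+1 (leqnn _); have := high k (leqnn _).
have -> : k.+1 + k = (2 * k).+1 by lia.
set X := \sum_(_ <= _ < _) _; set Y := \sum_(_ <= _ < _) _; nia.
Qed.

(** [f] labels the lines in the direction of [d]. Sites without a successor are line ends, at most
    one for each of the 2 k + 1 labels; every other site contributes a bond. *)
Lemma step_count (d : rel (I * I)) (f : I * I -> I) :
  {in hexset &, forall v v', (forall w, w \in hexset -> ~~ d v w) ->
    (forall w, w \in hexset -> ~~ d v' w) -> f v = f v' -> v = v'} ->
  #|hexset| <= \sum_(v in hexset) \sum_(w in hexset) d v w + (2 * k).+1.
Proof.
move=> finj; pose F := [set v in hexset | [forall w in hexset, ~~ d v w]].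
have cF : #|F| <= (2 * k).+1.
  rewrite -[leqRHS]card_ord -(card_in_imset (f := f)) ?max_card//.
  move=> v v'; rewrite !inE => /andP[vH /forall_inP dv] /andP[vH' /forall_inP dv'].
  by apply: finj; rewrite ?inE.
apply: leq_trans (leq_add (leqnn _) cF).
rewrite -(cardsID F hexset) addnC; apply: leq_add; last first.
  by apply: subset_leq_card; exact: subsetIr.
rewrite (big_setID F) /= addnC -[leqLHS]muln1 -sum_nat_const.
apply: leq_trans (leq_addr _ _); apply: leq_sum => v.
rewrite inE => /andP[vF vH]; move: vF; rewrite inE vH /= negb_forall_in.
by case/exists_inP => w wH; rewrite negbK => dw; rewrite (bigD1 w)//= dw.
Qed.

(** Three of the six lattice directions, one from each opposite pair. *)
Definition step1 : rel (I * I) := fun v w : I * I => (w.1 == v.1.+1 :> nat) && (w.2 == v.2 :> nat).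
Definition step2 : rel (I * I) := fun v w : I * I => (w.1 == v.1 :> nat) && (w.2 == v.2.+1 :> nat).
Definition step3 : rel (I * I) := fun v w : I * I =>
  (w.1.+1 == v.1 :> nat) && (w.2 == v.2.+1 :> nat).

Lemma hexset_at (a b : nat) : a <= 2 * k -> b <= 2 * k -> k <= a + b <= 3 * k ->
  exists w : I * I, [/\ w \in hexset, w.1 = a :> nat & w.2 = b :> nat].
Proof.
by move=> ha hb hab; exists (Ordinal (ha : a < (2 * k).+1), Ordinal (hb : b < (2 * k).+1));
  rewrite inE.
Qed.

Lemma pairI_eq (v v' : I * I) : v.1 = v'.1 :> nat -> v.2 = v'.2 :> nat -> v = v'.
Proof. by case: v v' => [i j] [i' j'] /= /val_inj-> /val_inj->. Qed.

Lemma ord_le2k (i : I) : i <= 2 * k.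
Proof. by rewrite -ltnS. Qed.

Lemma step1_count :
  #|hexset| <= \sum_(v in hexset) \sum_(w in hexset) step1 v w + (2 * k).+1.
Proof.
have aux (x : I * I) : x \in hexset -> (forall w, w \in hexset -> ~~ step1 x w) ->
    (x.1 = 2 * k :> nat) \/ (x.1 + x.2 = 3 * k).
  rewrite inE => hx dx; have [x1|x1] := eqVneq (nat_of_ord x.1) (2 * k); first by left.
  have [x3|x3] := eqVneq (x.1 + x.2) (3 * k); [by right|exfalso].
  have h1 := ord_le2k x.1; have h2 := ord_le2k x.2.
  have [|//||w [wH w1 w2]] := @hexset_at x.1.+1 x.2; try lia.
  by have := dx w wH; rewrite /step1 w1 w2 !eqxx.
apply: (step_count (f := snd)) => v v' hv hv' /(aux v hv) dv /(aux v' hv') dv' e.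
move: hv hv'; rewrite !inE => hv hv'; move/(congr1 (@nat_of_ord _)): e => e.
have h1 := ord_le2k v.1; have h2 := ord_le2k v'.1.
apply: pairI_eq; move: hv hv' dv dv' e h1 h2;
  by case: v v' => [[i hi] [j hj]] [[i' hi'] [j' hj']] /=; lia.
Qed.

Lemma step2_count :
  #|hexset| <= \sum_(v in hexset) \sum_(w in hexset) step2 v w + (2 * k).+1.
Proof.
have aux (x : I * I) : x \in hexset -> (forall w, w \in hexset -> ~~ step2 x w) ->
    (x.2 = 2 * k :> nat) \/ (x.1 + x.2 = 3 * k).
  rewrite inE => hx dx; have [x1|x1] := eqVneq (nat_of_ord x.2) (2 * k); first by left.
  have [x3|x3] := eqVneq (x.1 + x.2) (3 * k); [by right|exfalso].
  have h1 := ord_le2k x.1; have h2 := ord_le2k x.2.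
  have [//|||w [wH w1 w2]] := @hexset_at x.1 x.2.+1; try lia.
  by have := dx w wH; rewrite /step2 w1 w2 !eqxx.
apply: (step_count (f := fst)) => v v' hv hv' /(aux v hv) dv /(aux v' hv') dv' e.
move: hv hv'; rewrite !inE => hv hv'; move/(congr1 (@nat_of_ord _)): e => e.
have h1 := ord_le2k v.2; have h2 := ord_le2k v'.2.
apply: pairI_eq; move: hv hv' dv dv' e h1 h2;
  by case: v v' => [[i hi] [j hj]] [[i' hi'] [j' hj']] /=; lia.
Qed.

Lemma step3_count :
  #|hexset| <= \sum_(v in hexset) \sum_(w in hexset) step3 v w + (2 * k).+1.
Proof.
have aux (x : I * I) : x \in hexset -> (forall w, w \in hexset -> ~~ step3 x w) ->
    (x.1 = 0 :> nat) \/ (x.2 = 2 * k :> nat).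
  rewrite inE => hx dx; have [x1|x1] := eqVneq (nat_of_ord x.1) 0; first by left.
  have [x3|x3] := eqVneq (nat_of_ord x.2) (2 * k); [by right|exfalso].
  have h1 := ord_le2k x.1; have h2 := ord_le2k x.2.
  have [|||w [wH w1 w2]] := @hexset_at x.1.-1 x.2.+1; try lia.
  by have := dx w wH; rewrite /step3 w1 w2 prednK ?lt0n// !eqxx.
(* Lines in direction (-1, 1) have constant coordinate sum, which ranges over [k, 3 k]; hence the
   shift by k. *)
apply: (step_count (f := fun v => inord (v.1 + v.2 - k))) => v v' hv hv'.
move=> /(aux v hv) dv /(aux v' hv') dv' /(congr1 (@nat_of_ord _)).
move: hv hv'; rewrite !inE => hv hv'; rewrite !inordK; try lia.
move=> e; have h1 := ord_le2k v.1; have h2 := ord_le2k v'.1.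
have h3 := ord_le2k v.2; have h4 := ord_le2k v'.2.
apply: pairI_eq; move: hv hv' dv dv' e h1 h2 h3 h4;
  by case: v v' => [[i hi] [j hj]] [[i' hi'] [j' hj']] /=; lia.
Qed.

Section Points.
Local Open Scope ring_scope.
Variables (R : realType) (c u : R * R).
Hypothesis uu : dot u u = 1.

Definition hexpt (v : I * I) : R * R :=
  lat c u (v.1%:Z - k%:Z) (v.2%:Z - k%:Z).

Lemma hexpt_sqd v w : sqd (hexpt v) (hexpt w) =
  ((w.1%:Z - v.1%:Z) ^+ 2 + (w.1%:Z - v.1%:Z) * (w.2%:Z - v.2%:Z)
    + (w.2%:Z - v.2%:Z) ^+ 2)%:~R.
Proof.
rewrite lat_sqd//.
by congr (_%:~R); ring.
Qed.

(** The form a^2 + a b + b^2 is positive definite and takes integer values at integers. *)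
Lemma hexpt_sep v w : v != w -> 1 <= sqd (hexpt v) (hexpt w).
Proof.
move=> vw; rewrite hexpt_sqd -[1]/(1%:~R) ler_int.
have : ~ (w.1%:Z - v.1%:Z = 0 /\ w.2%:Z - v.2%:Z = 0).
  by case=> h1 h2; move/eqP: vw; apply; apply: pairI_eq; move: h1 h2;
    by case: v w => [[i hi] [j hj]] [[i' hi'] [j' hj']] /=; lia.
move: (w.1%:Z - v.1%:Z) (w.2%:Z - v.2%:Z) => a b ab.
suff : 0 < a ^+ 2 + a * b + b ^+ 2 by lia.
rewrite lt_neqAle eq_sym; apply/andP; split; last by nia.
apply/eqP => h; apply: ab; have b0 : b = 0 by nia.
by split=> //; move: h; rewrite b0; nia.
Qed.

(** The six steps exclude each other, and each is a vector of length 1. *)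
Lemma steps_adj v w : (step1 v w + step1 w v + (step2 v w + step2 w v)
  + (step3 v w + step3 w v) <= adj hexpt v w)%N.
Proof.
rewrite /adj hexpt_sqd -[1 in X in (_ <= X)%N]/(1%:~R) eqr_int /step1 /step2 /step3.
case: v w => [[i hi] [j hj]] [[i' hi'] [j' hj']] /=.
case: (altP (i' =P i.+1)) => [->|h1]; case: (altP (j' =P j)) => [->|h2]; lia.
Qed.

Lemma bonds_hexset : (6 * #|hexset| <= bonds hexpt hexset hexset + 6 * (2 * k).+1)%N.
Proof.
pose S (d : rel (I * I)) := (\sum_(v in hexset) \sum_(w in hexset) d v w)%N.
have SC d : S (fun v w => d w v) = S d by rewrite /S exchange_big.
have := step1_count; have := step2_count; have := step3_count.
rewrite -/(S step1) -/(S step2) -/(S step3) => h3 h2 h1.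
suff : (S step1 + S step1 + (S step2 + S step2) + (S step3 + S step3) <=
    bonds hexpt hexset hexset)%N by lia.
rewrite -[X in (S step1 + X)%N]SC -[X in (S step2 + X)%N]SC -[X in (S step3 + X)%N]SC.
rewrite /S /bonds -!big_split /=; apply: leq_sum => v _.
by rewrite -!big_split /=; apply: leq_sum => w _; exact: steps_adj.
Qed.

End Points.
End HexagonCount.

(** * The convex hull *)

Section Hull.
Local Open Scope classical_set_scope.
Local Open Scope ring_scope.
Variable R : realType.

Definition xy (v : 'rV[R]_2) : R * R := (v ord0 ord0, v ord0 ord_max).
Definition of_xy (q : R * R) : 'rV[R]_2 := Defs.point q.1 q.2.

Lemma xyK : cancel xy of_xy.
Proof.
move=> v; apply/rowP => j; rewrite mxE /=; case: eqVneq => [->//|j0].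
by congr (v _ _); apply/val_inj; case: j j0 => [[|[|j]]].
Qed.

Lemma of_xyK : cancel of_xy xy.
Proof. by case=> a b; rewrite /xy /of_xy !mxE. Qed.

Lemma xyB v w : xy (v - w) = xy v - xy w.
Proof. by rewrite /xy !mxE. Qed.

Lemma xy_lattice m n : xy (m%:~R *: e1 + n%:~R *: e2) = lat (0, 0) (1, 0) m n.
Proof.
rewrite /xy /e1 /e2 /Defs.point !mxE /= /lat /rot60 /=; congr pair; by field.
Qed.

Definition convex_comb (A : set 'rV[R]_2) :=
  forall x y (t : R), A x -> A y -> 0 <= t -> t <= 1 -> A (t *: x + (1 - t) *: y).

Lemma convex_setP (A : set 'rV[R]_2) : convex_set A <-> convex_comb A.
Proof.
split=> h x y t.
  move=> Ax Ay t0 t1; have := h x y (Itv01 t0 t1); rewrite !in_setE => /(_ Ax Ay).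
  by [].
rewrite !in_setE => Ax Ay; apply: h => //; lra.
Qed.

(* The coordinates of v in the basis e1, e2. *)
Definition lat1 (v : 'rV[R]_2) : R := v ord0 ord0 - Num.sqrt 3 / 3 * v ord0 ord_max.
Definition lat2 (v : 'rV[R]_2) : R := 2 * (Num.sqrt 3 / 3) * v ord0 ord_max.

Lemma lat1E (a b : R) : lat1 (a *: e1 + b *: e2) = a.
Proof.
rewrite /lat1 /e1 /e2 /Defs.point !mxE /=; have := @sqrt3_sqr R.
set s := Num.sqrt 3 => s3.
transitivity (a + b * (1 / 2) - b * (s * s) / 6); first by field.
by rewrite s3; field.
Qed.

Lemma lat2E (a b : R) : lat2 (a *: e1 + b *: e2) = b.
Proof.
rewrite /lat2 /e1 /e2 /Defs.point !mxE /=; have := @sqrt3_sqr R.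
set s := Num.sqrt 3 => s3.
transitivity (b * (s * s) / 3); first by field.
by rewrite s3; field.
Qed.

Definition strips (k : nat) : set 'rV[R]_2 := [set v |
  [/\ - k%:R <= lat1 v <= k%:R, - k%:R <= lat2 v <= k%:R
    & - k%:R <= lat1 v + lat2 v <= k%:R]].

Lemma strips_convex k : convex_set (strips k).
Proof.
apply/convex_setP => x y t [/andP[x1 x2] /andP[x3 x4] /andP[x5 x6]]
  [/andP[y1 y2] /andP[y3 y4] /andP[y5 y6]] t0 t1.
have e1 : lat1 (t *: x + (1 - t) *: y) = t * lat1 x + (1 - t) * lat1 y.
  by rewrite /lat1 !mxE; ring.
have e2 : lat2 (t *: x + (1 - t) *: y) = t * lat2 x + (1 - t) * lat2 y.
  by rewrite /lat2 !mxE; ring.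
have comb (a b : R) : - k%:R <= a -> a <= k%:R -> - k%:R <= b -> b <= k%:R ->
    - k%:R <= t * a + (1 - t) * b <= k%:R.
  by move=> h1 h2 h3 h4; apply/andP; split; nra.
rewrite /strips /= e1 e2; split; [exact: comb|exact: comb|].
have -> : t * lat1 x + (1 - t) * lat1 y + (t * lat2 x + (1 - t) * lat2 y) =
  t * (lat1 x + lat2 x) + (1 - t) * (lat1 y + lat2 y) by ring.
exact: comb.
Qed.

Definition corners k : set 'rV[R]_2 := [set` [:: B1 k; B2 k; B3 k; B4 k; B5 k; B6 k]].

Lemma cornersE k : [/\ @B1 R k = k%:R *: e1 + (- k%:R) *: e2, @B2 R k = k%:R *: e1 + 0 *: e2,
  @B3 R k = 0 *: e1 + k%:R *: e2, @B4 R k = (- k%:R) *: e1 + k%:R *: e2 &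
  @B5 R k = (- k%:R) *: e1 + 0 *: e2 /\ @B6 R k = 0 *: e1 + (- k%:R) *: e2].
Proof.
rewrite /B4 /B5 /B6 /B1 /B2 /B3 !scale0r !addr0 !add0r !scaleNr scalerBr opprB.
by rewrite (addrC (- _)).
Qed.

Lemma corners_strips k : corners k `<=` strips k.
Proof.
have [b1 b2 b3 b4 [b5 b6]] := cornersE k.
have k0 : 0 <= k%:R :> R by exact: ler0n.
move=> v; rewrite /corners /= !inE => /or4P[|||/or3P[]] /eqP->;
  rewrite /strips /= ?b1 ?b2 ?b3 ?b4 ?b5 ?b6 lat1E lat2E;
  by split; apply/andP; split; lra.
Qed.

(** Normalizing the coefficients gives a point between [U] and [V], which is then contracted towards
    0. *)
Lemma convex_cone (A : set 'rV[R]_2) U V a b : convex_comb A -> A 0 -> A U -> A V ->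
  0 <= a -> 0 <= b -> a + b <= 1 -> A (a *: U + b *: V).
Proof.
move=> cA A0 AU AV a0 b0 ab.
have [t0|t0] := eqVneq (a + b) 0.
  have [-> ->] : a = 0 /\ b = 0 by lra.
  by rewrite !scale0r addr0.
have W := cA U V (a / (a + b)) AU AV; have tp : 0 < a + b by rewrite lt0r t0 addr_ge0.
have {}W : A ((a / (a + b)) *: U + (1 - a / (a + b)) *: V).
  by apply: W; [rewrite divr_ge0// ltW|rewrite ler_pdivrMr// mul1r lerDl].
have := cA _ _ (a + b) W A0 (ltW tp) ab.
rewrite scaler0 addr0 scalerDr !scalerA mulrBr mulr1 mulrCA divff// mulr1.
by rewrite addrAC subrr add0r.
Qed.

(** The hexagon is cut into six triangles with vertex 0 and two adjacent corners. The signs of [m],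
    [n] and [m + n] select the triangle; [a] and [b] are the barycentric weights times k. *)
Lemma hexcoord_hull k m n : hexcoord k m n ->
  convex_hull (corners k) (m%:~R *: e1 + n%:~R *: e2).
Proof.
move=> h A [/convex_setP cA cornA].
have [b1 b2 b3 b4 [b5 b6]] := cornersE k.
have inA B : B \in [:: B1 k; B2 k; B3 k; B4 k; B5 k; B6 k] -> A B.
  by move=> hB; apply: cornA.
have [A1 A2 A3] : [/\ A (B1 k), A (B2 k) & A (B3 k)].
  by split; apply: inA; rewrite !inE eqxx ?orbT.
have [A4 A5 A6] : [/\ A (B4 k), A (B5 k) & A (B6 k)].
  by split; apply: inA; rewrite !inE eqxx ?orbT.
have A0 : A 0.
  have := cA _ _ (1 / 2) A1 A4; have -> : 1 - 1 / 2 = 1 / 2 :> R by lra.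
  by rewrite -scalerDr /B4 subrr scaler0; apply; lra.
have [k0|k0] := eqVneq k 0%N.
  have [-> ->] : m = 0 /\ n = 0 by move: h; rewrite /hexcoord k0; lia.
  by rewrite !scale0r addr0.
have kp : 0 < k%:R :> R by rewrite ltr0n lt0n.
suff H U V (a b : int) : A U -> A V -> 0 <= a -> 0 <= b -> a + b <= k%:Z ->
    m%:~R *: e1 + n%:~R *: e2 = (a%:~R / k%:R) *: U + (b%:~R / k%:R) *: V ->
    A (m%:~R *: e1 + n%:~R *: e2).
  have dist (x y z t a b : R) : (a / k%:R) *: (x *: e1 + y *: e2) +
      (b / k%:R) *: (z *: e1 + t *: e2) =
      ((a * x + b * z) / k%:R) *: e1 + ((a * y + b * t) / k%:R) *: e2 :> 'rV[R]_2.
    by apply/rowP => j; rewrite !mxE; field; rewrite gt_eqF.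
  have fin (x y : R) : m%:~R = x -> n%:~R = y ->
    m%:~R *: e1 + n%:~R *: e2 = x *: e1 + y *: e2 :> 'rV[R]_2 by move=> -> ->.
  have kn : k%:R != 0 :> R by rewrite gt_eqF.
  move: h; rewrite /hexcoord => h.
  have [m0|m0] := lerP 0 m; have [n0|n0] := lerP 0 n.
  - apply: (H _ _ m n A2 A3); try lia.
    by rewrite b2 b3 dist; apply: fin; field.
  - have [s0|s0] := lerP 0 (m + n).
      apply: (H _ _ (- n) (m + n) A1 A2); try lia.
      by rewrite b1 b2 dist !(rmorphN, rmorphD) /=; apply: fin; field.
    apply: (H _ _ m (- m - n) A1 A6); try lia.
    by rewrite b1 b6 dist !(rmorphN, rmorphD) /=; apply: fin; field.
  - have [s0|s0] := lerP 0 (m + n).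
      apply: (H _ _ (- m) (m + n) A4 A3); try lia.
      by rewrite b4 b3 dist !(rmorphN, rmorphD) /=; apply: fin; field.
    apply: (H _ _ n (- m - n) A4 A5); try lia.
    by rewrite b4 b5 dist !(rmorphN, rmorphD) /=; apply: fin; field.
  - apply: (H _ _ (- m) (- n) A5 A6); try lia.
    by rewrite b5 b6 dist !(rmorphN, rmorphD) /=; apply: fin; field.
move=> AU AV a0 b0 ab ->; apply: convex_cone => //.
- by rewrite divr_ge0 ?ler0z// ltW.
- by rewrite divr_ge0 ?ler0z// ltW.
- by rewrite -mulrDl ler_pdivrMr// mul1r -rmorphD /= -[k%:R]/((k%:Z)%:~R) ler_int.
Qed.

(** The strips are a convex set containing the corners and so bound the hull from outside; the
    triangles give the converse. *)
Lemma hexagonE k : hexagon k =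
  [set v | exists m n, hexcoord k m n /\ v = m%:~R *: e1 + n%:~R *: e2] :> set 'rV[R]_2.
Proof.
apply/seteqP; split=> v; last first.
  by case=> m [n [h ->]]; split; [exists m, n|exact: hexcoord_hull].
case=> -[m [n vE]] hv; exists m, n; split=> //.
have : strips k v by apply: hv; split; [exact: strips_convex|exact: corners_strips].
rewrite vE /strips /= lat1E lat2E -rmorphD /= -[k%:R]/((k%:Z)%:~R) -rmorphN /= !ler_int.
by case=> /andP[h1 h2] /andP[h3 h4] /andP[h5 h6]; apply/and5P; split=> //; apply/andP.
Qed.

End Hull.

(** * Energy *)

(** For these N, 48 N - 12 is the perfect square (12 k + 6)^2. *)
Lemma max_bonds_arith k N E : (N = 3 * k * k.+1 + 1)%N -> (48 * N <= (6 * N - E) ^ 2 + 12)%N ->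
  (E <= 6 * N)%N -> (E <= 6 * N - (12 * k + 6))%N.
Proof.
move=> NE h le; rewrite leqNgt; apply/negP => lt.
have : ((6 * N - E) ^ 2 <= (12 * k + 5) ^ 2)%N by rewrite leq_exp2r//; lia.
by move: h; set X := (_ ^ 2)%N; rewrite NE; nia.
Qed.

Section Energy.
Local Open Scope classical_set_scope.
Local Open Scope ring_scope.
Variable R : realType.

Lemma sqd_self (q : R * R) : sqd q q = 0.
Proof. by rewrite /sqd /dot /=; ring. Qed.

(** Choosing an occupant for each site is injective, hence onto by equality of cardinals. *)
Lemma hexagon_exhausts (T : finType) (q : T -> R * R) k c u : dot u u = 1 ->
  #|T| = #|hexset k| ->
  (forall m n, hexcoord k m n -> exists2 y, y \in [set: T]%SET & q y = lat c u m n) ->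
  forall i, exists m n, hexcoord k m n /\ q i = lat c u m n.
Proof.
move=> uu cT occ i0.
pose g (v : 'I_(2 * k).+1 * 'I_(2 * k).+1) := odflt i0 [pick y | q y == hexpt c u v].
have gE v : v \in hexset k -> q (g v) = hexpt c u v.
  rewrite hexsetE => /occ[y _ qy]; rewrite /g; case: pickP => [z /eqP//|/(_ y)].
  by rewrite qy eqxx.
have ginj : {in hexset k &, injective g}.
  move=> v w vH wH vw; apply/eqP/negPn/negP => /(hexpt_sep c uu).
  by rewrite -gE// -gE// vw sqd_self ler10.
have : g @: hexset k == [set: T]%SET.
  by rewrite eqEcard subsetT (card_in_imset ginj) cardsT cT leqnn.
move=> /eqP/setP/(_ i0); rewrite in_setT => /imsetP[v vH ->].
by exists (v.1%:Z - k%:Z), (v.2%:Z - k%:Z); rewrite -hexsetE gE.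
Qed.

Section Configuration.
Variables (N : nat) (x : 'I_N -> 'rV[R]_2).
Let q i := xy (x i).

Definition packing := forall i j, i != j -> 1 <= sqd (q i) (q j).

Lemma enorm_sqd i j : enorm (x i - x j) = Num.sqrt (sqd (q i) (q j)).
Proof.
by rewrite sqdC /sqd /q -xyB /enorm /dot /xy !big_ord_recl big_ord0 addr0 -!expr2
  (_ : lift _ _ = ord_max)//; apply/val_inj.
Qed.

Lemma sqd_ge0 (a b : R * R) : 0 <= sqd a b.
Proof. exact: dot_ge0. Qed.

Lemma enorm_lt1 i j : (enorm (x i - x j) < 1) = (sqd (q i) (q j) < 1).
Proof. by rewrite enorm_sqd -[in LHS]sqrtr1 ltr_sqrt. Qed.

Lemma V_HR_packing i j : packing -> i != j ->
  V_HR (enorm (x i - x j)) = (- (adj q i j)%:R)%:E.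
Proof.
move=> pk ij; rewrite /V_HR enorm_lt1 ltNge pk//= enorm_sqd -[X in _ == X]sqrtr1.
rewrite eqr_sqrt ?sqd_ge0// -/(adj q i j); case: (adj q i j) => //.
by rewrite oppr0.
Qed.

Lemma energy_packing : packing ->
  energy x = (- (bonds q [set: 'I_N]%SET [set: 'I_N]%SET)%:R)%:E.
Proof.
move=> pk; rewrite /energy /bonds natr_sum -sumrN -sumEFin.
rewrite [RHS](eq_bigl predT); last by move=> i; rewrite in_setT.
apply: eq_bigr => i _; rewrite natr_sum -sumrN -sumEFin.
rewrite [RHS](eq_bigl predT); last by move=> j; rewrite in_setT.
rewrite [RHS](bigD1 i)//=.
have -> : adj q i i = false by apply/negP => /adj_neq; rewrite eqxx.
rewrite oppr0 add0e; apply: eq_big => [j|j ij]; first by rewrite eq_sym.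
exact: V_HR_packing.
Qed.

Lemma V_HR_neqNy (r : R) : V_HR r != -oo%E.
Proof. by rewrite /V_HR; case: ifP => // _; case: ifP. Qed.

Lemma energy_overlap : ~ packing -> energy x = +oo%E.
Proof.
move=> npk; have [i [j [ij h]]] : exists i j, i != j /\ sqd (q i) (q j) < 1.
  apply: contrapT => h; apply: npk => i j ij; rewrite leNgt; apply/negP => h'.
  by apply: h; exists i, j.
rewrite /energy; apply/esum_eqyP => [a _|].
  by apply/eqP => /esum_eqNyP[b [_ _ /eqP]]; apply/negP/V_HR_neqNy.
exists i; split; [exact: mem_index_enum|by []|].
apply/esum_eqyP => [b _|]; first exact: V_HR_neqNy.
exists j; split; [exact: mem_index_enum|by []|].
by rewrite /V_HR enorm_lt1 h.
Qed.

End Configuration.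

(** * The hexagon as a minimizer *)

Section HexagonConfiguration.
Variable k : nat.
Local Notation I := 'I_(2 * k).+1.
Local Notation H := (hexset k).

Definition hexconf (i : 'I_#|H|) : 'rV[R]_2 := of_xy (hexpt (0, 0) (1, 0) (enum_val i)).

Let unit10 : dot (1, 0) (1, 0) = 1 :> R.
Proof. by rewrite /dot /=; ring. Qed.

Lemma hexconf_packing : packing hexconf.
Proof.
move=> i j ij; rewrite /hexconf !of_xyK; apply: hexpt_sep => //.
by apply: contraNneq ij => /enum_val_inj ->.
Qed.

Lemma hexconf_inj : injective hexconf.
Proof.
move=> i j ij; apply/eqP/negPn/negP => /hexconf_packing.
by rewrite ij sqd_self ler10.
Qed.

Lemma range_hexconf : range hexconf = hexagon k.
Proof.
rewrite hexagonE; apply/seteqP; split=> v.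
  case=> i _ <-; have := enum_valP i; rewrite hexsetE => h.
  by do 2 eexists; split; first exact: h; rewrite -[RHS]xyK xy_lattice.
case=> m [n [h vE]]; have [w wH [mE nE]] := hexcoord_hexset h.
exists (enum_rank_in wH w) => //; rewrite /hexconf enum_rankK_in//.
by rewrite vE -[RHS]xyK xy_lattice mE nE.
Qed.

Lemma bonds_hexconf : (6 * #|H| - (12 * k + 6) <=
  bonds (fun i => xy (hexconf i)) [set: 'I_#|H|]%SET [set: 'I_#|H|]%SET)%N.
Proof.
have -> : bonds (fun i => xy (hexconf i)) [set: 'I_#|H|]%SET [set: 'I_#|H|]%SET =
    bonds (hexpt (0, 0) (1, 0) : I * I -> R * R) H H.
  rewrite /bonds [RHS]big_enum_val [LHS](eq_bigl predT); last by move=> i; rewrite in_setT.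
  apply: eq_bigr => i _; rewrite [RHS]big_enum_val [LHS](eq_bigl predT); last first.
    by move=> j; rewrite in_setT.
  by apply: eq_bigr => j _; rewrite /adj /hexconf !of_xyK.
have := @bonds_hexset k R (0, 0) (1, 0) unit10; lia.
Qed.

Lemma hexconf_minimal (y : 'I_#|H| -> 'rV[R]_2) : (energy hexconf <= energy y)%E.
Proof.
have [pk|npk] := pselect (packing y); last by rewrite (energy_overlap npk) leey.
rewrite (energy_packing pk) (energy_packing hexconf_packing) lee_fin lerN2 ler_nat.
apply: leq_trans bonds_hexconf; apply: max_bonds_arith (card_hexset k) _ _.
  by have := bonds_bound pk [set: _]%SET; rewrite cardsT card_ord.
by have := bonds_le6 pk [set: _]%SET; rewrite cardsT card_ord.
Qed.

End HexagonConfiguration.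

(** Acting from the right on row vectors, it sends the first basis vector to [u]. *)
Definition rotation (u : R * R) : 'M[R]_2 :=
  \matrix_(i < 2, j < 2) (if i == ord0 then (if j == ord0 then u.1 else u.2)
                          else (if j == ord0 then - u.2 else u.1)).

Lemma rotation_orthogonal u : dot u u = 1 -> rotation u *m (rotation u)^T = 1%:M.
Proof.
rewrite /dot => uu; apply/matrixP => i j; rewrite !mxE !big_ord_recl big_ord0 !mxE /=.
by case: i => [[|[|?]] ?] //; case: j => [[|[|?]] ?] //; rewrite /= -?uu; ring.
Qed.

Lemma det_rotation u : dot u u = 1 -> \det (rotation u) = 1.
Proof.
rewrite /dot => uu; rewrite (expand_det_row _ ord0) !big_ord_recl big_ord0 /cofactor.
by rewrite !det_mx11 !mxE /= -[RHS]uu; ring.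
Qed.

Lemma rotation_lat c u m n : xy (of_xy (lat (0, 0) (1, 0) m n) *m rotation u + of_xy c) =
  lat c u m n.
Proof.
rewrite /xy !mxE !big_ord_recl !big_ord0 !mxE /= /lat /rot60 /=.
by congr pair; field.
Qed.

End Energy.

(** * Ground states with a hexagonal number of atoms *)

Local Open Scope classical_set_scope.

Theorem proposition2p7 (R : realType) (k N : nat)
    (hk : (1 <= k)%N) (hN : N = (3 * k * (k + 1) + 1)%N) :
  ground_state N (@hexagon R k) /\
  forall S : set 'rV[R]_2, ground_state N S ->
    exists f : 'rV[R]_2 -> 'rV[R]_2, rigid_motion f /\ S = f @` (@hexagon R k).
Proof.
have NE : N = #|hexset k| by rewrite hN card_hexset addn1 !addn1.
rewrite {}NE {N hN}; split.
  exists (@hexconf R k); split; first by rewrite range_hexconf.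
    exact: hexconf_inj.
  exact: hexconf_minimal.
move=> S [x [-> xinj xmin]].
(* The hexagon has finite energy, so a minimizer has no overlaps. *)
have pk : packing x.
  apply: contrapT => /energy_overlap e; have := xmin (@hexconf R k).
  by rewrite e (energy_packing (@hexconf_packing R k)).
have := xmin (@hexconf R k); rewrite (energy_packing pk) (energy_packing (@hexconf_packing R k)).
rewrite lee_fin lerN2 ler_nat => hb.
have cT : #|[set: 'I_#|hexset k|]%SET| = (3 * k * k.+1 + 1)%N.
  by rewrite cardsT card_ord card_hexset.
(* One inequality is the bond bound, the other is minimality compared with the hexagon. *)
have bT : bonds (fun i => xy (x i)) [set: 'I_#|hexset k|]%SET [set: 'I_#|hexset k|]%SET =
    (6 * #|[set: 'I_#|hexset k|]%SET| - (12 * k + 6))%N.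
  apply/eqP; rewrite eqn_leq; apply/andP; split.
    exact: max_bonds_arith cT (bonds_bound pk _) (bonds_le6 pk _).
  by apply: leq_trans hb; rewrite cardsT card_ord; exact: bonds_hexconf.
have [c [u [uu occ]]] := hexagon_occupied pk cT bT.
have ext := hexagon_exhausts uu (card_ord _) occ.
exists (fun v => v *m rotation u + of_xy c)%R; split.
  exists (rotation u), (of_xy c); split=> //; [exact: rotation_orthogonal|exact: det_rotation].
rewrite hexagonE; apply/seteqP; split=> v.
  case=> i _ <-; have [m [n [h e]]] := ext i.
  exists (m%:~R *: e1 + n%:~R *: e2)%R; first by exists m, n.
  by apply: (can_inj (@xyK R)); rewrite /= e -(xyK (_ *: _ + _)%R) xy_lattice rotation_lat.
case=> _ [m [n [h ->]]] <-; have [y _ e] := occ m n h.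
exists y => //; apply: (can_inj (@xyK R)).
by rewrite /= e -(xyK (_ *: _ + _)%R) xy_lattice rotation_lat.
Qed.
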